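(* Let $0<r\le 1$, let $X$ and $Y$ be r.i. spaces on $(0,1)$ and let $\psi\in\mathcal{A}_0$. The following are equivalent: (i) There exists a constant $C>0$ such that, for every measurable $f\in L^0(0,1)$, $$\|f\|_Y\le C\left(\left\|\frac{O(|f|^r,\cdot)^{1/r}}{\psi(\cdot)}\right\|_X+\|f\|_{L^r}\right).$$ (ii) There exists a constant $C>0$ such that, for every $h\in X^{(1/r)}$, $$\|\overline{T}_{\psi,r}h\|_{Y^{(1/r)}}\le C\|h\|_{X^{(1/r)}}.$$ (iii) There exists a constant $C>0$ such that, for every $f\in X$, $$\|\overline{Q}_{\psi,r}f\|_Y\le C\|f\|_X.$$
   Context: All function spaces are over $(0,1)$ with Lebesgue measure; $L^0=L^0(0,1)$ is the space of a.e. finite measurable functions. The decreasing rearrangement of $f$ is $f^*(s)=\inf\{t>0:|\{x\in(0,1):|f(x)|>t\}|\le s\}$, and $f^{**}(t)=\frac1t\int_0^t f^*(s)\,ds$ for $0<t<1$. For $0<r\le1$, $O(|f|^r,t):=(|f|^r)^{**}(t)-(|f|^r)^*(t)$. Also $\|f\|_{L^r}=(\int_0^1|f|^r)^{1/r}$. An r.i. space $X$ is a Banach function space on $(0,1)$ (in the sense of Bennett--Sharpley) such that $\|f\|_X=\|g\|_X$ whenever $f^*=g^*$; norms are $+\infty$ for functions not in the space. For $p>0$ the $p$-convexification is $X^{(p)}=\{f:|f|^p\in X\}$, $\|f\|_{X^{(p)}}=\||f|^p\|_X^{1/p}$. Class $\mathcal{A}_0$: for a positive function $\psi$ on $(0,1)$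 put $m_\psi(t)=\sup\{\psi(st)/\psi(s):0<s<1,\ st<1\}$, $t>0$. If $m_\psi(t)<\infty$ for all $t>0$, the fundamental indices of $\psi$ are $\underline{\beta}_\psi=\lim_{t\to0^+}\frac{\log m_\psi(t)}{\log t}$ and $\overline{\beta}_\psi=\lim_{t\to\infty}\frac{\log m_\psi(t)}{\log t}$. $\mathcal{A}_0$ is the class of increasing positive functions $\psi:(0,1)\to(0,\infty)$ with $m_\psi<\infty$, $\psi(0^+)=0$ and $0<\underline{\beta}_\psi\le\overline{\beta}_\psi<1$. Operators: $\overline{Q}_{\psi,r}f(t)=\left(\int_t^1(\psi(s)|f(s)|)^r\frac{ds}{s}\right)^{1/r}$ and $\overline{T}_{\psi,r}h(t)=\int_t^1\psi(s)^r h(s)\frac{ds}{s}$, $0<t<1$. *)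

(* Defs.v *)
From HB Require Import structures.
From mathcomp Require Export all_boot all_order all_algebra.
From mathcomp Require Export all_classical all_reals all_analysis measurable_realfun.
Export Order.TTheory GRing.Theory Num.Theory.
Export numFieldNormedType.Exports.

Set Implicit Arguments.
Unset Strict Implicit.
Unset Printing Implicit Defensive.

Local Open Scope classical_set_scope.
Local Open Scope ring_scope.
Local Open Scope ereal_scope.

(* Functions on (0,1) are maps [R -> \bar R] whose values outside (0,1) are
   irrelevant.  Measurable means Borel measurable: every Lebesgue measurable
   function agrees a.e. with a Borel one. *)

Definition unit_itv {R : realType} : set R := `]0%R, 1%R[.

Definition mplus {R : realType} : set (R -> \bar R) :=
  [set f : R -> \bar R | measurable_fun unit_itv f /\ forall x, unit_itv x -> 0 <= f x].

Definition ae_unit {R : realType} (P : R -> Prop) : Prop :=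
  {ae (@lebesgue_measure R), forall x, unit_itv x -> P x}.

Definition L0 {R : realType} : set (R -> \bar R) :=
  [set f : R -> \bar R | measurable_fun unit_itv f /\ ae_unit (fun x => f x \is a fin_num)].

Definition distribution_fun {R : realType} (f : R -> \bar R) (t : R) : \bar R :=
  @lebesgue_measure R [set x | unit_itv x /\ t%:E < `|f x|].

(* The infimum of the empty set is +oo. *)
Definition rearr {R : realType} (f : R -> \bar R) (s : R) : \bar R :=
  ereal_inf [set t%:E | t in [set t : R | (0 < t)%R /\
                                          distribution_fun f t <= s%:E]].

Definition max_rearr {R : realType} (f : R -> \bar R) (t : R) : \bar R :=
  (t^-1)%:E * \int[@lebesgue_measure R]_(s in `]0%R, t[) rearr f s.

Definition abs_pow {R : realType} (f : R -> \bar R) (p : R) : R -> \bar R :=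
  fun x => `|f x| `^ p.

Definition oscillation {R : realType} (g : R -> \bar R) (t : R) : \bar R :=
  max_rearr g t - rearr g t.

Definition Lr_norm {R : realType} (r : R) (f : R -> \bar R) : \bar R :=
  (\int[@lebesgue_measure R]_(x in unit_itv) abs_pow f r x) `^ r^-1.

(* Bennett-Sharpley, Interpolation of Operators, Definition I.1.1, for the
   measure space (0,1). *)
Record banach_function_norm {R : realType}
    (rho : (R -> \bar R) -> \bar R) : Prop := BanachFunctionNorm {
  bfn_ge0 : forall f, mplus f -> 0 <= rho f ;
  bfn_eq0 : forall f, mplus f -> rho f = 0 <-> ae_unit (fun x => f x = 0) ;
  bfn_scale : forall (a : R) f, (0 <= a)%R -> mplus f ->
    rho (fun x => a%:E * f x) = a%:E * rho f ;
  bfn_triangle : forall f g, mplus f -> mplus g ->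
    rho (fun x => f x + g x) <= rho f + rho g ;
  bfn_mono : forall f g, mplus f -> mplus g ->
    ae_unit (fun x => g x <= f x) -> rho g <= rho f ;
  bfn_fatou : forall (u : nat -> R -> \bar R) f,
    (forall n, mplus (u n)) -> mplus f ->
    ae_unit (fun x => nondecreasing_seq (fun n => u n x) /\
                      u n x @[n --> \oo] --> f x) ->
    rho (u n) @[n --> \oo] --> rho f ;
  bfn_indic : forall E : set R, measurable E -> E `<=` unit_itv ->
    rho (fun x => (\1_E x)%:E) < +oo ;
  bfn_int : forall E : set R, measurable E -> E `<=` unit_itv ->
    exists2 C : R, (0 < C)%R & forall f, mplus f ->
      \int[@lebesgue_measure R]_(x in E) f x <= C%:E * rho f
}.

Record ri_space (R : realType) := RISpace {
  ri_fun : (R -> \bar R) -> \bar R ;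
  ri_bfn : banach_function_norm ri_fun ;
  ri_rearr : forall f g : R -> \bar R,
    measurable_fun unit_itv f -> measurable_fun unit_itv g ->
    (forall s : R, unit_itv s -> rearr f s = rearr g s) ->
    ri_fun (fun x => `|f x|) = ri_fun (fun x => `|g x|)
}.

Definition ri_norm {R : realType} (X : ri_space R) (f : R -> \bar R) : \bar R :=
  ri_fun X (fun x => `|f x|).

Definition ri_mem {R : realType} (X : ri_space R) : set (R -> \bar R) :=
  [set f : R -> \bar R | measurable_fun unit_itv f /\ ri_norm X f < +oo].

Definition cvx_norm {R : realType} (X : ri_space R) (p : R)
    (f : R -> \bar R) : \bar R :=
  (ri_norm X (abs_pow f p)) `^ p^-1.

Definition cvx_mem {R : realType} (X : ri_space R) (p : R) :
    set (R -> \bar R) :=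
  [set f : R -> \bar R | measurable_fun unit_itv f /\ ri_mem X (abs_pow f p)].

Definition dilation_fun {R : realType} (psi : R -> R) (t : R) : \bar R :=
  ereal_sup [set (psi (s * t) / psi s)%:E |
             s in [set s : R | (0 < s < 1)%R /\ (s * t < 1)%R]].

Definition is_lower_index {R : realType} (psi : R -> R) (b : R) : Prop :=
  (ln (fine (dilation_fun psi t)) / ln t)%R @[t --> (0%R : R)^'+] --> b.

Definition is_upper_index {R : realType} (psi : R -> R) (b : R) : Prop :=
  (ln (fine (dilation_fun psi t)) / ln t)%R @[t --> (+oo)%R] --> b.

(* "Increasing" is taken in the wide sense.  The limits defining the indices
   always exist here, since log m_psi is subadditive in log t. *)
Record class_A0 {R : realType} (psi : R -> R) : Prop := ClassA0 {
  A0_pos : forall t, unit_itv t -> (0 < psi t)%R ;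
  A0_incr : forall s t, unit_itv s -> unit_itv t ->
    (s <= t)%R -> (psi s <= psi t)%R ;
  A0_fin : forall t : R, (0 < t)%R -> dilation_fun psi t < +oo ;
  A0_at0 : psi t @[t --> (0%R : R)^'+] --> (0%R : R) ;
  A0_index : exists bl bu : R,
    [/\ is_lower_index psi bl, is_upper_index psi bu,
        (0 < bl)%R, (bl <= bu)%R & (bu < 1)%R]
}.

Definition Qop {R : realType} (psi : R -> R) (r : R) (f : R -> \bar R)
    (t : R) : \bar R :=
  (\int[@lebesgue_measure R]_(s in `]t, 1%R[)
     (((psi s)%:E * `|f s|) `^ r * (s^-1)%:E)) `^ r^-1.

(* Here h is signed; the integral is finite whenever h lies in X^{(1/r)}. *)
Definition Top {R : realType} (psi : R -> R) (r : R) (h : R -> \bar R)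
    (t : R) : \bar R :=
  \int[@lebesgue_measure R]_(s in `]t, 1%R[)
     ((powR (psi s) r)%:E * h s * (s^-1)%:E).

(* Main.v *)
From mathcomp Require Import ring lra.
Require Import Defs.

(** The theorem compares three inequalities through the oscillation
    O(g,t) = W(t) - w(t) of g = |f|^r, where w is the decreasing rearrangement of
    g and W(t) is the mean of w over (0,t).

    From (iii) to (i).  One has W(t) = int_t^1 O(g,s) ds/s + W(1).  As w <= W, and
    f is equimeasurable with w^(1/r), the rearrangement of f is bounded by a
    multiple of Q F plus the norm of f in L^r, where F = O(g)^(1/r) / psi
    ([integral_rearr_le_osc] and [oscillation_bound_of_Qop_bound]).

    From (ii) to (iii) one substitutes h = |f|^r ([Qop_bound_of_Top_bound]).

    From (i) to (ii) one tests (i) on f = (T|h|)^(1/r).  The function f^r = T|h|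
    is decreasing and continuous, hence its own rearrangement, and its
    oscillation at t is the mean of psi^r |h| over (0,t) ([oscillation_tail_le]).
    By Jensen's inequality O^(1/r) / psi is at most P_psi k, where k = |h|^(1/r)
    and P_psi k(t) = (t psi(t))^-1 int_0^t psi k.  It remains to bound the Hardy
    operator P_psi on X ([hardy_bounded], [Top_bound_of_oscillation_bound]).

    That bound rests on the lower index of psi and on the effect of dilations and
    averages on a rearrangement invariant norm.  A positive lower index yields an
    integer N and q < 1 such that psi(u) <= q psi(t) for u <= t/N.  On the
    partition of (0,1) into the intervals [N^-(m+1), N^-m[ the function P_psi k is
    dominated by a series whose j-th term is, up to a constant, (q/N)^j times the
    j-fold dilation by N of the averages of k.

    A dilation by N multiplies the norm by at most N, as the dilated function is
    the sum of N functions equimeasurable with a restriction of the original one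
    ([ri_norm_adic_shift]).  Averaging over an interval does not increase the norm
    ([ri_norm_average]): after a rearrangement inside the interval the function
    dominates a step function on blocks of equal length, the cyclic permutations
    of the blocks are equimeasurable, and their average is constant; as the
    blocks shrink the Fatou property recovers the mean.  The series then sums to
    a geometric series in q. *)

Set Implicit Arguments.
Unset Strict Implicit.
Unset Printing Implicit Defensive.

Local Open Scope classical_set_scope.
Local Open Scope ring_scope.
Local Open Scope ereal_scope.

Local Notation leb := (@lebesgue_measure _).

(** * Measurability and monotone functions *)

Lemma measurable_unit (R : realType) : measurable (@unit_itv R).
Proof. exact: measurable_itv. Qed.
#[local] Hint Extern 0 (measurable unit_itv) => exact: measurable_unit : core.
#[local] Hint Extern 0 (measurable (@unit_itv _)) => exact: measurable_unit : core.

Lemma unit_itvP (R : realType) (x : R) : unit_itv x <-> (0 < x < 1)%R.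
Proof. by rewrite /unit_itv /= in_itv /=. Qed.

Lemma measurable_fun_gt (R : realType) (D : set R) (f : R -> \bar R) :
  (forall t : R, measurable (D `&` [set x | t%:E < f x])) -> measurable_fun D f.
Proof.
move=> H mD; apply: (measurability _ (ErealGenOInfty.measurableE R)) => //.
move=> _ [_ [t ->] <-]; rewrite (_ : _ `&` _ = D `&` [set x | t%:E < f x]) //.
by apply/seteqP; split=> x /=; rewrite in_itv/= andbT.
Qed.

Lemma antitone_measurable (R : realType) (D : set R) (f : R -> \bar R) :
  is_interval D ->
  (forall x y, D x -> D y -> (x <= y)%R -> f y <= f x) -> measurable_fun D f.
Proof.
move=> iD af; apply: measurable_fun_gt => t.
apply: is_interval_measurable => x y [Dx tx] [Dy ty] z /andP[xz zy].
have Dz : D z by apply: (iD _ _ Dx Dy); rewrite xz.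
by split=> //=; apply: lt_le_trans (af _ _ Dz Dy zy).
Qed.

Lemma monotone_measurable (R : realType) (D : set R) (f : R -> \bar R) :
  is_interval D ->
  (forall x y, D x -> D y -> (x <= y)%R -> f x <= f y) -> measurable_fun D f.
Proof.
move=> iD af; apply: measurable_fun_gt => t.
apply: is_interval_measurable => x y [Dx tx] [Dy ty] z /andP[xz zy].
have Dz : D z by apply: (iD _ _ Dx Dy); rewrite xz.
by split=> //=; apply: lt_le_trans (af _ _ Dx Dz xz).
Qed.

Lemma unit_interval (R : realType) : is_interval (@unit_itv R).
Proof. exact: interval_is_interval. Qed.

Lemma ico_subset_unit (R : realType) (a b : R) : (0 < a)%R -> (b <= 1)%R ->
  `[a, b[ `<=` unit_itv.
Proof.
move=> a0 b1 x; rewrite /= in_itv/= => /andP[ax xb]; apply/unit_itvP.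
by rewrite (lt_le_trans a0)// (lt_le_trans xb).
Qed.

Lemma oo_subset_unit (R : realType) (t : R) : (t <= 1)%R -> `]0%R, t[ `<=` unit_itv.
Proof.
move=> t1 x; rewrite /= in_itv/= => /andP[x0 xt]; apply/unit_itvP.
by rewrite x0 (lt_le_trans xt).
Qed.

Lemma tail_subset_unit (R : realType) (t : R) : (0 <= t)%R -> `]t, 1%R[ `<=` unit_itv.
Proof.
move=> t0 u; rewrite /= in_itv/= => /andP[tu u1]; apply/unit_itvP.
by rewrite u1 (le_lt_trans t0).
Qed.

Lemma measurable_inv_unit (R : realType) :
  measurable_fun (@unit_itv R) (fun s => (s^-1)%:E).
Proof.
apply: antitone_measurable; first exact: unit_interval.
move=> x y /unit_itvP/andP[x0 _] /unit_itvP/andP[y0 _] xy.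
by rewrite lee_fin lef_pV2 ?posrE.
Qed.

(** * Decreasing rearrangements *)

Lemma measurable_level (R : realType) (f : R -> \bar R) (t : R) :
  measurable_fun unit_itv f -> measurable [set x | unit_itv x /\ t%:E < `|f x|].
Proof.
move=> mf; apply: (emeasurable_fun_o_infty (D := unit_itv) (f := fun x => `|f x|)) => //.
exact: measurableT_comp.
Qed.

Lemma distribution_antitone (R : realType) (f : R -> \bar R) (t t' : R) :
  measurable_fun unit_itv f -> (t <= t')%R ->
  distribution_fun f t' <= distribution_fun f t.
Proof.
move=> mf tt'; apply: le_measure; rewrite ?inE; try exact: measurable_level.
by move=> x [Ux /= h]; split => //; apply: le_lt_trans h; rewrite lee_fin.
Qed.

Lemma lebesgue_length (R : realType) (c d : R) {b0 b1 : bool} : (c <= d)%R ->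
  leb [set` Interval (BSide b0 c) (BSide b1 d)] = (d - c)%:E.
Proof.
move=> cd; rewrite lebesgue_measure_itv/= lte_fin.
case: ltP => h; first by rewrite EFinB.
by rewrite (_ : d = c) ?subrr//; apply/le_anti; rewrite cd h.
Qed.

Lemma lebesgue_unit (R : realType) : leb (@unit_itv R) = 1.
Proof. by rewrite lebesgue_length// subr0. Qed.

Lemma distribution_le1 (R : realType) (f : R -> \bar R) (t : R) :
  measurable_fun unit_itv f -> distribution_fun f t <= 1.
Proof.
move=> mf; rewrite -lebesgue_unit; apply: le_measure; rewrite ?inE //.
  exact: measurable_level.
by move=> x [].
Qed.

(** Right continuity of the distribution function, in the form that turns
    strict inequalities into strict inequalities: the level sets at heights
    t + 1/(n+1) increase to the level set at height t. *)
Lemma distribution_gt (R : realType) (f : R -> \bar R) (s t : R) :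
  measurable_fun unit_itv f -> s%:E < distribution_fun f t ->
  exists2 t' : R, (t < t')%R & s%:E < distribution_fun f t'.
Proof.
move=> mf st; apply: contrapT => H.
have {}H (t' : R) : (t < t')%R -> distribution_fun f t' <= s%:E.
  by move=> tt'; rewrite leNgt; apply/negP => h; apply: H; exists t'.
pose F (n : nat) := [set x | unit_itv x /\ (t + n.+1%:R^-1)%:E < `|f x|].
have FU : \bigcup_n F n = [set x | unit_itv x /\ t%:E < `|f x|].
  apply/seteqP; split=> [x [n _ [Ux /= h]]|x [Ux /= h]].
    by split => //; apply: lt_trans h; rewrite lte_fin ltrDl.
  move: h; case fa : `|f x| => [a| |//] ta.
    rewrite lte_fin -subr_gt0 in ta.
    have [n] := ltr_add_invr ta; rewrite add0r => hn.
    by exists n => //; split => //=; rewrite fa lte_fin -ltrBrDl.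
  by exists 0%N => //; split => //=; rewrite fa ltry.
have mF n : measurable (F n) by exact: measurable_level.
have := @nondecreasing_cvg_mu _ _ _ leb F mF.
rewrite FU => /(_ (measurable_level _ mf)) cvgF.
suff : distribution_fun f t <= s%:E by rewrite leNgt st.
have {}cvgF : leb \o F @ \oo --> distribution_fun f t.
  apply: cvgF => m n mn; apply/subsetPset => x [Ux /= h]; split => //=.
  by apply: le_lt_trans h; rewrite lee_fin lerD2l lef_pV2 ?posrE// ler_nat.
rewrite -(cvg_lim _ cvgF) //; apply: lime_le; first by apply/cvg_ex; eexists; exact: cvgF.
by apply: nearW => n; apply: H; rewrite ltrDl.
Qed.

Lemma rearr_ge0 (R : realType) (f : R -> \bar R) (s : R) : 0 <= rearr f s.
Proof. by apply: le_ereal_inf_tmp => _ [t [/ltW t0 _] <-]; rewrite lee_fin. Qed.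

Lemma rearr_antitone (R : realType) (f : R -> \bar R) (s s' : R) :
  (s <= s')%R -> rearr f s' <= rearr f s.
Proof.
move=> ss'; apply: ereal_inf_le_tmp => _ [t [t0 h] <-]; exists t => //; split => //.
by apply: le_trans h _; rewrite lee_fin.
Qed.

Lemma measurable_rearr (R : realType) (D : set R) (f : R -> \bar R) :
  is_interval D -> measurable_fun D (rearr f).
Proof. by move=> iD; apply: antitone_measurable => // x y _ _; exact: rearr_antitone. Qed.

(** The rearrangement is the generalized inverse of the distribution function;
    right continuity makes the adjunction exact for strict inequalities. *)
Lemma lt_rearr (R : realType) (f : R -> \bar R) (s t : R) :
  measurable_fun unit_itv f -> (0 <= t)%R ->
  (t%:E < rearr f s) = (s%:E < distribution_fun f t).
Proof.
move=> mf t0; apply/idP/idP => [tr|/(distribution_gt mf)[t' tt' st']]; last first.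
  apply: (@lt_le_trans _ _ t'%:E); first by rewrite lte_fin.
  apply: le_ereal_inf_tmp => _ [u [u0 hu] <-]; rewrite leNgt; apply/negP.
  rewrite lte_fin => /ltW /(distribution_antitone mf) h.
  by have := lt_le_trans st' (le_trans h hu); rewrite ltxx.
suff [t' [t'0 tt' ht']] : exists t' : R, [/\ (0 < t')%R, (t <= t')%R & t'%:E < rearr f s].
  apply: (@lt_le_trans _ _ (distribution_fun f t')); last exact: distribution_antitone.
  rewrite ltNge; apply/negP => h; have : rearr f s <= t'%:E.
    by apply: ereal_inf_lbound; exists t'.
  by rewrite leNgt ht'.
case: (rearr f s) tr => [a|_|//].
  rewrite lte_fin => ta; exists ((t + a) / 2)%R; split; [| |rewrite lte_fin]; lra.
by exists (t + 1)%R; split; [lra|lra|rewrite ltry].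
Qed.

(** By [lt_rearr] the level set of the rearrangement is the interval from 0 to
    the value of the distribution function. *)
Lemma distribution_rearr (R : realType) (f : R -> \bar R) (t : R) :
  measurable_fun unit_itv f -> (0 <= t)%R ->
  distribution_fun (rearr f) t = distribution_fun f t.
Proof.
move=> mf t0; have d1 := distribution_le1 t mf.
have d0 : 0 <= distribution_fun f t by exact: measure_ge0.
have dfin : distribution_fun f t \is a fin_num.
  by rewrite ge0_fin_numE// (le_lt_trans d1) ?ltry.
rewrite {1}/distribution_fun.
rewrite (_ : [set _ | _] = `]0%R, fine (distribution_fun f t)[%classic).
  rewrite lebesgue_measure_itv/= lte_fin.
  case: ltP => h; first by rewrite sube0 fineK.
  by rewrite -[RHS]fineK//; congr EFin; apply/le_anti; rewrite h fine_ge0.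
apply/seteqP; split => s /=; rewrite gee0_abs ?rearr_ge0// lt_rearr// in_itv/=.
  by case=> /unit_itvP/andP[-> _]; rewrite -lte_fin fineK.
move=> /andP[s0]; rewrite -lte_fin fineK// => h; split => //; apply/unit_itvP.
by rewrite s0 -lte_fin (lt_le_trans h).
Qed.

Lemma eq_rearr (R : realType) (f g : R -> \bar R) (s : R) :
  (forall t : R, (0 < t)%R -> distribution_fun f t = distribution_fun g t) ->
  rearr f s = rearr g s.
Proof.
move=> fg; congr ereal_inf; congr image; apply/seteqP.
by split => t /= [t0]; rewrite fg.
Qed.

Lemma eq_distribution (R : realType) (f g : R -> \bar R) (t : R) :
  (forall x, unit_itv x -> f x = g x) -> distribution_fun f t = distribution_fun g t.
Proof.
by move=> fg; congr (leb _); apply/seteqP; split => x /= [Ux]; rewrite fg.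
Qed.

(** If the rearrangement were infinite at s, all the level sets above the
    integers would have measure larger than s, and so would their
    intersection, the null set where f is infinite. *)
Lemma rearr_fin (R : realType) (f : R -> \bar R) (s : R) :
  L0 f -> (0 < s)%R -> rearr f s < +oo.
Proof.
move=> [mf fin] s0; rewrite ltey; apply/negP => /eqP roo.
have big (n : nat) : s%:E < distribution_fun f n%:R.
  by rewrite -lt_rearr// roo ltry.
pose F (n : nat) := [set x | unit_itv x /\ n%:R%:E < `|f x|].
have mF n : measurable (F n) by exact: measurable_level.
have mI : measurable (\bigcap_n F n) by apply: bigcapT_measurable.
have F0 : leb (F 0%N) < +oo.
  exact: le_lt_trans (distribution_le1 _ mf) (ltry _).
have cvgF : leb \o F @ \oo --> leb (\bigcap_n F n).
  apply: nonincreasing_cvg_mu => // m n mn; apply/subsetPset => x [Ux /= h].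
  by split => //=; apply: le_lt_trans h; rewrite lee_fin ler_nat.
have : s%:E <= leb (\bigcap_n F n).
  rewrite -(cvg_lim _ cvgF) //; apply: lime_ge.
    by apply/cvg_ex; eexists; exact: cvgF.
  by apply: nearW => n; exact: ltW (big n).
suff -> : leb (\bigcap_n F n) = 0 by rewrite lee_fin leNgt s0.
case: fin => N [mN N0 sub]; apply: (subset_measure0 _ _ _ N0) => // x Fx.
apply: sub => /= /(_ (proj1 (Fx 0%N Logic.I))) fx.
have := proj2 (Fx (Num.bound (fine `|f x|)) Logic.I).
rewrite -[X in _ < X]fineK ?abse_fin_num// lte_fin ltNge ltW//.
by rewrite archi_boundP// fine_ge0.
Qed.

(** * The norm of a rearrangement invariant space *)

Section RiNorm.
Variables (R : realType) (X : ri_space R).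
Implicit Types f g : R -> \bar R.

Lemma mplus_abs f : measurable_fun unit_itv f -> mplus (fun x => `|f x|).
Proof. by move=> mf; split => //; exact: measurableT_comp. Qed.

Lemma ri_norm_ge0 f : measurable_fun unit_itv f -> 0 <= ri_norm X f.
Proof. by move=> /mplus_abs; exact: (bfn_ge0 (ri_bfn X)). Qed.

Lemma ri_norm_le f g : measurable_fun unit_itv f -> measurable_fun unit_itv g ->
  (forall x, unit_itv x -> `|f x| <= `|g x|) -> ri_norm X f <= ri_norm X g.
Proof.
move=> /mplus_abs mf /mplus_abs mg fg.
by apply: (bfn_mono (ri_bfn X)) => //; apply: aeW => x; exact: fg.
Qed.

Lemma eq_ri_norm f g : measurable_fun unit_itv f -> measurable_fun unit_itv g ->
  (forall x, unit_itv x -> `|f x| = `|g x|) -> ri_norm X f = ri_norm X g.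
Proof.
by move=> mf mg fg; apply/le_anti/andP; split; apply: ri_norm_le => // x /fg ->.
Qed.

Lemma equimeasurable_ri_norm f g :
  measurable_fun unit_itv f -> measurable_fun unit_itv g ->
  (forall t : R, (0 < t)%R -> distribution_fun f t = distribution_fun g t) ->
  ri_norm X f = ri_norm X g.
Proof. by move=> mf mg fg; apply: ri_rearr => // s _; exact: eq_rearr. Qed.

Lemma ri_normD f g : mplus f -> mplus g ->
  ri_norm X (fun x => f x + g x) <= ri_norm X f + ri_norm X g.
Proof.
move=> [mf f0] [mg g0].
apply: le_trans (bfn_triangle (ri_bfn X) (mplus_abs mf) (mplus_abs mg)).
apply: (bfn_mono (ri_bfn X)); [|exact: mplus_abs (emeasurable_funD _ _)|].
  split=> [|x Ux]; last by rewrite adde_ge0.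
  by apply: emeasurable_funD; exact: measurableT_comp.
by apply: aeW => x Ux; exact: lee_abs_add.
Qed.

Lemma ri_normZ (a : R) f : (0 <= a)%R -> measurable_fun unit_itv f ->
  ri_norm X (fun x => a%:E * f x) = a%:E * ri_norm X f.
Proof.
move=> a0 mf; rewrite /ri_norm -(bfn_scale (ri_bfn X)) //; last exact: mplus_abs.
by congr (ri_fun X _); apply/funext => x; rewrite abseM/= ger0_norm.
Qed.

(** The Fatou property, in the form used throughout: a bound on the norms of an
    increasing sequence passes to its limit. *)
Lemma ri_norm_lim_le (u : nat -> R -> \bar R) f (B : \bar R) :
  (forall n, mplus (u n)) -> mplus f ->
  (forall x, unit_itv x -> nondecreasing_seq (u ^~ x) /\ u ^~ x @ \oo --> f x) ->
  (forall n, ri_norm X (u n) <= B) -> ri_norm X f <= B.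
Proof.
move=> mu mf cv le.
have cvX : ri_norm X (u n) @[n --> \oo] --> ri_norm X f.
  apply: (bfn_fatou (ri_bfn X)) => [n||].
  - exact: mplus_abs (mu n).1.
  - exact: mplus_abs mf.1.
  - apply: aeW => x Ux; have [nd cvx] := cv x Ux; have fx := mf.2 x Ux.
    rewrite (_ : (fun n => `|u n x|) = u ^~ x) ?(gee0_abs fx) //.
    by apply/funext => n; rewrite gee0_abs// (mu n).2.
rewrite -(cvg_lim _ cvX) //; apply: lime_le; last exact: nearW.
by apply/cvg_ex; eexists; exact: cvX.
Qed.

Lemma ri_norm_sum n (u : nat -> R -> \bar R) : (forall i, mplus (u i)) ->
  ri_norm X (fun x => \sum_(i < n) u i x) <= \sum_(i < n) ri_norm X (u i).
Proof.
move=> mu; elim: n => [|n IH].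
  rewrite big_ord0 (_ : (fun x => _) = (fun x => 0%:E * u 0%N x)).
    by rewrite ri_normZ ?mul0e//; exact: (mu 0%N).1.
  by apply/funext => x; rewrite big_ord0 mul0e.
rewrite big_ord_recr/=; under eq_fun do rewrite big_ord_recr/=.
apply: le_trans (ri_normD _ _) _ => //; last by rewrite leeD2r.
split=> [|x Ux]; last by apply: sume_ge0 => i _; exact: (mu i).2.
by apply: emeasurable_sum => i; exact: (mu i).1.
Qed.

(** Countable subadditivity: finite subadditivity for the partial sums and the
    Fatou property for their limit. *)
Lemma ri_norm_nneseries (u : nat -> R -> \bar R) : (forall i, mplus (u i)) ->
  ri_norm X (fun x => \sum_(i <oo) u i x) <= \sum_(i <oo) ri_norm X (u i).
Proof.
move=> mu; apply: (@ri_norm_lim_le (fun n x => \sum_(0 <= i < n) u i x)).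
- move=> n; split=> [|x Ux]; last by apply: sume_ge0 => i _; exact: (mu i).2.
  by apply: emeasurable_sum => i; exact: (mu i).1.
- split=> [|x Ux]; last by apply: nneseries_ge0 => i _ _; exact: (mu i).2.
  apply: ge0_emeasurable_sum => [k x Ux _|k _]; [exact: (mu k).2|exact: (mu k).1].
- move=> x Ux; split.
    by apply: ereal_nondecreasing_series => i _ _; exact: (mu i).2.
  by apply: is_cvg_nneseries => i _ _; exact: (mu i).2.
- move=> n; under eq_fun do rewrite big_mkord.
  apply: le_trans (ri_norm_sum _ _) _ => //.
  rewrite -(big_mkord xpredT (fun i => ri_norm X (u i))).
  by apply: nneseries_lim_ge => i _ _; apply: ri_norm_ge0; exact: (mu i).1.
Qed.

End RiNorm.

(** * Tonelli's theorem and the layer cake formula *)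

(** Tonelli's theorem for the integrand a(s) b(u) 1_{E(s,u)}, with the relation
    written as a restriction of the inner domain: this is the form in which the
    triangles u < s and the subgraphs t < |f(x)| occur. *)
Lemma tonelli_rel (R : realType) (A B : set R) (a b : R -> \bar R)
    (E : R -> R -> bool) :
  measurable A -> measurable B ->
  measurable_fun [set: R * R] (fun p => E p.1 p.2) ->
  measurable_fun A a -> measurable_fun B b ->
  (forall s, A s -> 0 <= a s) -> (forall u, B u -> 0 <= b u) ->
  \int[leb]_(s in A) (a s * \int[leb]_(u in B `&` [set u | E s u]) b u) =
  \int[leb]_(u in B) (b u * \int[leb]_(s in A `&` [set s | E s u]) a s).
Proof.
move=> mA mB mE ma mb a0 b0.
pose a' := a \_ A; pose b' := b \_ B.
have a'0 s : 0 <= a' s by apply: erestrict_ge0.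
have b'0 s : 0 <= b' s by apply: erestrict_ge0.
have ma' : measurable_fun setT a' by apply/(measurable_restrictT _ _).1.
have mb' : measurable_fun setT b' by apply/(measurable_restrictT _ _).1.
pose f (p : R * R) := a' p.1 * b' p.2 * (if E p.1 p.2 then 1 else 0).
have mf : measurable_fun setT f.
  apply: emeasurable_funM; last exact: measurable_fun_ifT.
  apply: emeasurable_funM.
    exact: (measurableT_comp ma' measurable_fst).
  exact: (measurableT_comp mb' measurable_snd).
have f0 p : 0 <= f p by rewrite /f mule_ge0// ?mule_ge0//; case: ifP.
have mES s : measurable [set u | E s u].
  rewrite (_ : [set u | E s u] = (fun u => E s u) @^-1` [set true])//.
  rewrite -[X in measurable X]setTI.
  by apply: (measurableT_comp mE (pair1_measurable s)).
have mEU u : measurable [set s | E s u].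
  rewrite (_ : [set s | E s u] = (fun s => E s u) @^-1` [set true])//.
  rewrite -[X in measurable X]setTI.
  by apply: (measurableT_comp mE (pair2_measurable u)).
transitivity (\int[leb]_s \int[leb]_u f (s, u)).
  rewrite integral_mkcond; apply: eq_integral => s _.
  rewrite patchE; case: ifPn => sA; last first.
    rewrite integral0_eq// => u _; rewrite /f /= /a' patchE (negbTE sA) !mul0e //.
  rewrite integral_mkcond -(@ge0_integralZl _ _ _ leb _ measurableT).
  - apply: eq_integral => u _; rewrite /f /a' /b' !patchE /= sA.
    rewrite in_setI; case: (u \in B) => /=; last by rewrite !mule0 mul0e.
    rewrite -muleA; congr (_ * _).
    rewrite (_ : (u \in _) = E s u); last by apply/idP/idP; rewrite inE.
    by case: ifP; rewrite ?mule1 ?mule0.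
  - apply/(measurable_restrictT b (measurableI _ _ mB (mES s))).
    exact: (measurable_funS mB (@subIsetl _ _ _) mb).
  - by move=> u _; apply: erestrict_ge0 => v [Bv _]; exact: b0.
  - by apply: a0; rewrite inE in sA.
rewrite (@fubini_tonelli _ _ _ _ R (@lebesgue_measure R) (@lebesgue_measure R) f mf f0).
rewrite [RHS]integral_mkcond; apply: eq_integral => u _.
rewrite patchE; case: ifPn => uB; last first.
  by rewrite integral0_eq// => s _; rewrite /f /= /b' patchE (negbTE uB) !(mule0, mul0e).
rewrite [in RHS]integral_mkcond -(@ge0_integralZl _ _ _ leb _ measurableT).
- apply: eq_integral => s _; rewrite /f /a' /b' !patchE /= uB.
  rewrite in_setI; case: (s \in A) => /=; last by rewrite !mule0 !mul0e.
  rewrite [a s * _]muleC -muleA; congr (_ * _).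
  rewrite (_ : (s \in _) = E s u); last by apply/idP/idP; rewrite inE.
  by case: ifP; rewrite ?mule1 ?mule0.
- apply/(measurable_restrictT a (measurableI _ _ mA (mEU u))).
  exact: (measurable_funS mA (@subIsetl _ _ _) ma).
- by move=> s _; apply: erestrict_ge0 => v [Av _]; exact: a0.
- by apply: b0; rewrite inE in uB.
Qed.

Lemma measurable_lt_rel (R : realType) :
  measurable_fun [set: R * R] (fun p => (p.1 < p.2)%R).
Proof. exact: measurable_fun_ltr. Qed.

Lemma lebesgue_below (R : realType) (y : \bar R) : 0 <= y ->
  leb (`]0%R, +oo[ `&` [set t : R | t%:E < y]) = y.
Proof.
move=> y0; case: y y0 => [y||//] y0.
  rewrite (_ : _ `&` _ = `]0%R, y[%classic).
    rewrite lebesgue_measure_itv/= lte_fin; case: ltP; first by rewrite sube0.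
    by rewrite lee_fin in y0 => yle; congr EFin; apply/le_anti; rewrite y0 yle.
  by apply/seteqP; split=> t /=; rewrite !in_itv/= andbT lte_fin;
    [move=> [-> ->]|move=> /andP[-> ->]].
rewrite (_ : _ `&` _ = `]0%R, +oo[%classic).
  by rewrite lebesgue_measure_itv/= ltry sube0.
by apply/seteqP; split=> t /=; rewrite !in_itv/= andbT; [case|move=> ->; rewrite ltry].
Qed.

(** Layer cake formula: |f(x)| is the length of the set of heights t below
    |f(x)|, and the two integrations are exchanged. *)
Lemma integral_distribution (R : realType) (f : R -> \bar R) :
  measurable_fun unit_itv f ->
  \int[leb]_(x in unit_itv) `|f x| = \int[leb]_(t in `]0%R, +oo[) distribution_fun f t.
Proof.
move=> mf; pose f' := (fun x => `|f x|) \_ unit_itv.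
have mf' : measurable_fun setT f'.
  by apply/(measurable_restrictT _ _).1 => //; exact: measurableT_comp.
have f'E x : unit_itv x -> f' x = `|f x| by move=> Ux; rewrite /f' patchT// inE.
have mE : measurable_fun [set: R * R] (fun p => p.2%:E < f' p.1).
  apply: measurable_fun_lte.
    exact: (measurableT_comp (@EFin_measurable _ _) measurable_snd).
  exact: (measurableT_comp mf' measurable_fst).
have := @tonelli_rel R unit_itv `]0%R, +oo[ (cst 1) (cst 1)
  (fun x t => t%:E < f' x) (@measurable_unit R) (measurable_itv _) mE.
move=> /(_ (measurable_cst _) (measurable_cst _)).
move=> /(_ (fun _ _ => lee01) (fun _ _ => lee01)) H.
transitivity (\int[leb]_(x in unit_itv)
   (1 * \int[leb]_(u in `]0%R, +oo[ `&` [set u | u%:E < f' x]) (cst 1 u))).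
  apply: eq_integral => x; rewrite inE => Ux.
  rewrite integral_cst/=; last first.
    exact: (emeasurable_fun_infty_o (measurable_itv _) (@EFin_measurable _ _)).
  by rewrite !mul1e lebesgue_below f'E.
rewrite H; apply: eq_integral => t _.
rewrite integral_cst/= ?mul1e; last first.
  exact: (emeasurable_fun_o_infty (@measurable_unit R)
    (measurable_funS measurableT (@subsetT _ _) mf')).
rewrite /distribution_fun; congr (lebesgue_measure _).
apply/seteqP; split=> x [Ux h]; have e := f'E x Ux; split.
- exact: Ux.
- by rewrite -e; exact: h.
- exact: Ux.
- have h' : t%:E < `|f x| := h.
  by rewrite -e in h'; exact: h'.
Qed.

Lemma equimeasurable_integral (R : realType) (f g : R -> \bar R) :
  measurable_fun unit_itv f -> measurable_fun unit_itv g ->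
  (forall t : R, (0 < t)%R -> distribution_fun f t = distribution_fun g t) ->
  \int[leb]_(x in unit_itv) `|f x| = \int[leb]_(x in unit_itv) `|g x|.
Proof.
move=> mf mg fg; rewrite !integral_distribution//; apply: eq_integral => t.
by rewrite inE/= in_itv/= andbT => /fg.
Qed.

(** * Averaging over an interval *)

Definition glue (R : realType) (a b : R) (g f : R -> \bar R) (x : R) : \bar R :=
  if (a <= x < b)%R then g x else f x.

Lemma glue_measurable (R : realType) (a b : R) (g f : R -> \bar R) :
  measurable_fun `[a, b[ g -> measurable_fun unit_itv f ->
  measurable_fun unit_itv (glue a b g f).
Proof.
move=> mg mf; apply: measurable_fun_if => //.
- apply: measurable_and.
    by apply: measurable_fun_ler => //; exact: measurable_cst.
  by apply: measurable_fun_ltr => //; exact: measurable_cst.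
- by apply: (measurable_funS (measurable_itv _) _ mg) => x [_]; rewrite /= in_itv.
- by apply: (measurable_funS (@measurable_unit R) _ mf) => x [].
Qed.

(** Outside [a, b[ the level sets of the two functions coincide, so only their
    parts inside the interval have to be compared. *)
Lemma glue_equimeasurable (R : realType) (a b : R) (g g' f : R -> \bar R) (t : R) :
  (0 < a)%R -> (b <= 1)%R ->
  measurable_fun unit_itv (glue a b g f) -> measurable_fun unit_itv (glue a b g' f) ->
  leb (`[a, b[ `&` [set x | t%:E < `|g x|]) = leb (`[a, b[ `&` [set x | t%:E < `|g' x|]) ->
  distribution_fun (glue a b g f) t = distribution_fun (glue a b g' f) t.
Proof.
move=> a0 b1 mg mg' eqI.
have aux h : measurable_fun unit_itv (glue a b h f) ->
    distribution_fun (glue a b h f) t =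
      leb ([set x | unit_itv x /\ t%:E < `|f x|] `\` `[a, b[) +
      leb (`[a, b[ `&` [set x | t%:E < `|h x|]).
  move=> mh; rewrite /distribution_fun.
  rewrite (measureDI leb (measurable_level t mh) (measurable_itv `[a, b[%R)).
  congr (lebesgue_measure _ + lebesgue_measure _);
    apply/seteqP; split=> x /=; rewrite in_itv/= /glue.
  - by case=> -[Ux]; case: ifP => // _ h1 _; split.
  - by case=> -[Ux h1] /negP/negbTE ->; split.
  - by case=> -[Ux]; case: ifP => // _ h1 _; split.
  - case=> axb h1; split => //; rewrite axb; split => //.
    by apply: (ico_subset_unit a0 b1); rewrite /= in_itv.
by rewrite !aux// eqI.
Qed.

Section Blocks.
Variables (R : realType) (a b : R) (n : nat).
Hypothesis ab : (a < b)%R.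

Let d := ((b - a) / n.+1%:R)%R.
Let d0 : (0 < d)%R. Proof. by rewrite divr_gt0// subr_gt0. Qed.
Let dn : (d * n.+1%:R = b - a)%R. Proof. by rewrite /d divfK// pnatr_eq0. Qed.

(** The interval [a, b[ is cut into n+1 blocks of equal length; this is the
    index of the block of x. *)
Definition block (x : R) : 'I_n.+1 := inord (Num.truncn ((x - a) / ((b - a) / n.+1%:R))).

Lemma blockP (x : R) (i : 'I_n.+1) : (a <= x < b)%R ->
  (block x == i) = (a + i%:R * d <= x < a + i.+1%:R * d)%R.
Proof.
move=> /andP[ax xb]; rewrite /block -/d.
have y0 : (0 <= (x - a) / d)%R by rewrite divr_ge0 ?subr_ge0// ltW.
have := truncn_itv y0; set k := Num.truncn _ => /andP[k1 k2].
have kn : (k < n.+1)%N.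
  rewrite -(ltr_nat R); apply: le_lt_trans k1 _.
  by rewrite ltr_pdivrMr// mulrC dn; lra.
have -> : (inord k == i) = (k == i :> nat) by rewrite -val_eqE/= inordK.
rewrite -lerBrDl -ltrBlDl -ler_pdivlMr// -ltr_pdivrMr//.
apply/idP/idP => [/eqP <-|/andP[h1 h2]]; first by rewrite k1.
rewrite eqn_leq; apply/andP; split; rewrite -ltnS -(ltr_nat R).
  exact: le_lt_trans k1 h2.
exact: le_lt_trans h1 k2.
Qed.

Lemma block_set (P : set 'I_n.+1) :
  `[a, b[ `&` [set x | P (block x)] =
  \bigcup_(i in P) `[(a + i%:R * d)%R, (a + i.+1%:R * d)%R[%classic.
Proof.
apply/seteqP; split => x /=.
  rewrite in_itv/= => -[axb Pb]; exists (block x) => //=.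
  by rewrite in_itv/= -blockP// eqxx.
move=> [i Pi /=]; rewrite in_itv/= => /andP[h1 h2].
have axb : (a <= x < b)%R.
  apply/andP; split.
    by apply: le_trans h1; rewrite lerDl mulr_ge0// ltW.
  by apply: (lt_le_trans h2); rewrite -lerBrDl -dn mulrC ler_pM2l// ler_nat.
rewrite in_itv/= axb; split => //.
suff /eqP -> : block x == i by [].
by rewrite blockP// h1.
Qed.

Lemma measurable_block_set (P : set 'I_n.+1) : measurable (`[a, b[ `&` [set x | P (block x)]).
Proof.
rewrite block_set; apply: fin_bigcup_measurable; first exact: finite_finset.
by move=> i _; exact: measurable_itv.
Qed.

Lemma lebesgue_block_set (P : set 'I_n.+1) :
  leb (`[a, b[ `&` [set x | P (block x)]) = (\sum_(i \in P) d%:E)%R.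
Proof.
rewrite block_set measure_fin_bigcup; [|exact: finite_finset| |by []].
- apply: eq_fsbigr => i _; apply: etrans (lebesgue_measure_itv _) _.
  rewrite /= lte_fin.
  rewrite ltrD2l ltr_pM2r// ltr_nat ltnSn -EFinB; congr EFin.
  by rewrite -natr1; ring.
- move=> i j _ _ [x [/=]]; rewrite !in_itv/= => hi hj.
  have axb : (a <= x < b)%R.
    have : (`[a, b[ `&` [set x | [set i] (block x)]) x.
      by rewrite block_set; exists i => //=; rewrite in_itv.
    by case; rewrite /= in_itv.
  by move: hi hj; rewrite -!blockP// => /eqP <- /eqP <-.
Qed.

End Blocks.

Lemma glue_mplus (R : realType) (a b : R) (g f : R -> \bar R) :
  measurable_fun `[a, b[ g -> (forall x, (a <= x < b)%R -> 0 <= g x) -> mplus f ->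
  mplus (glue a b g f).
Proof.
move=> mg g0 [mf f0]; split; first exact: glue_measurable.
by move=> x Ux; rewrite /glue; case: ifP => [/g0//|_]; exact: f0.
Qed.

Lemma measurable_block (R : realType) (a b : R) n (al : 'I_n.+1 -> \bar R) :
  (a < b)%R -> measurable_fun `[a, b[ (fun x => al (block a b n x)).
Proof.
move=> ab _ B mB; rewrite (_ : _ `&` _ = `[a, b[ `&` [set x | (al @^-1` B) (block a b n x)])//.
exact: measurable_block_set.
Qed.

Lemma sume_cst (R : realType) n (x : \bar R) : 0 <= x ->
  \sum_(i < n) x = (n%:R)%:E * x.
Proof.
move=> x0; elim: n => [|n IH]; first by rewrite big_ord0 mul0e.
by rewrite big_ord_recr/= IH -natr1 EFinD ge0_muleDl ?lee_fin// mul1e.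
Qed.

Section Average.
Variables (R : realType) (X : ri_space R) (a b : R).
Hypotheses (a0 : (0 < a)%R) (ab : (a < b)%R) (b1 : (b <= 1)%R).

(** A function that is constant on each of the n+1 blocks is equimeasurable with
    the functions obtained by permuting the blocks cyclically, and the average
    of these n+1 functions is constant on [a, b[. *)
Lemma ri_norm_block_average n (al : 'I_n.+1 -> \bar R) (f : R -> \bar R) :
  mplus f -> (forall i, 0 <= al i) ->
  ri_norm X (glue a b (cst ((n.+1%:R^-1)%:E * \sum_(i < n.+1) al i)) f) <=
  ri_norm X (glue a b (fun x => al (block a b n x)) f).
Proof.
move=> mf al0.
(* The addition of 'I_n.+1 is cyclic, so j permutes the blocks. *)
pose g (j : 'I_n.+1) := glue a b (fun x => al (block a b n x + j)%R) f.
have mg j : mplus (g j).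
  by apply: glue_mplus => //; exact: (measurable_block (fun i => al (i + j)%R)).
have gE j : ri_norm X (g j) = ri_norm X (g 0%R).
  apply: equimeasurable_ri_norm; [exact: (mg _).1|exact: (mg _).1|move=> t t0].
  apply: glue_equimeasurable => //; [exact: (mg _).1|exact: (mg _).1|].
  pose P (k : 'I_n.+1) : set 'I_n.+1 := [set i | t%:E < `|al (i + k)%R|].
  have H k : leb (`[a, b[ `&` [set x | t%:E < `|al (block a b n x + k)%R|]) =
      (\sum_(i \in P k) ((b - a) / n.+1%:R)%:E)%R.
    exact: (lebesgue_block_set ab (P k)).
  rewrite !H.
  rewrite (reindex_fsbig (fun i => i + j)%R (P j) (P 0%R))//.
  split.
  - by move=> i; rewrite /P /= addr0.
  - by move=> i k _ _; exact: addIr.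
  - move=> i; rewrite /P /= addr0 => h.
    by exists (i - j)%R; rewrite /= subrK.
have g0E : g 0%R = glue a b (fun x => al (block a b n x)) f.
  by apply/funext => x; rewrite /g /glue addr0.
have ms : measurable_fun unit_itv (fun x => \sum_(j < n.+1) g j x).
  by apply: emeasurable_sum => j; exact: (mg j).1.
rewrite (@eq_ri_norm _ X _ (fun x => (n.+1%:R^-1)%:E * \sum_(j < n.+1) g j x)).
- rewrite ri_normZ ?invr_ge0//.
  have := ri_norm_sum X n.+1 (fun j => mg (inord j)).
  under eq_fun do under eq_bigr do rewrite inord_val.
  under eq_bigr do rewrite inord_val gE.
  rewrite g0E => H.
  rewrite lee_pdivrMl ?ltr0n//; apply: le_trans H _.
  by rewrite sume_cst//; apply: ri_norm_ge0; rewrite -g0E; exact: (mg _).1.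
- by apply: glue_measurable mf.1; exact: measurable_cst.
- by apply: emeasurable_funM => //; exact: measurable_cst.
- move=> x Ux; congr (`|_|); rewrite /g /glue; case: ifP => _.
    congr (_ * _); rewrite [LHS](reindex_inj (addrI (block a b n x))).
    by apply: eq_bigr => j _.
  by rewrite sume_cst ?mf.2// muleA -EFinM mulVf ?mul1e// pnatr_eq0.
Qed.

Variable f : R -> \bar R.
Hypothesis mf : mplus f.

Let f1 := glue a b f (cst 0).
Let w := rearr f1.
Let ba0 : (0 < b - a)%R. Proof. by rewrite subr_gt0. Qed.

Let mfI : measurable_fun `[a, b[ f.
Proof. exact: (measurable_funS (@measurable_unit R) (ico_subset_unit a0 b1) mf.1). Qed.

Let mf1 : measurable_fun unit_itv f1.
Proof. by apply: glue_measurable mfI _; exact: measurable_cst. Qed.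

Let distribution_piece (t : R) : (0 <= t)%R ->
  distribution_fun f1 t = leb (`[a, b[ `&` [set x | t%:E < `|f x|]).
Proof.
move=> t0; rewrite /distribution_fun; congr (lebesgue_measure _).
apply/seteqP; split=> x /=; rewrite in_itv/= /f1 /glue.
  by case=> Ux; case: ifP => // _; rewrite abse0 lte_fin ltNge t0.
case=> axb h; rewrite axb; split => //.
by apply: (ico_subset_unit a0 b1); rewrite /= in_itv.
Qed.

Let distribution_piece_le (t : R) : (0 <= t)%R -> distribution_fun f1 t <= (b - a)%:E.
Proof.
move=> t0; rewrite distribution_piece// -(@lebesgue_length R a b true true (ltW ab)).
apply: le_measure; rewrite ?inE//; apply: (measurable_lte _ (measurable_cst _)) => //.
exact: measurableT_comp.
Qed.

Lemma rearr_piece_eq0 (s : R) : (b - a <= s)%R -> w s = 0.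
Proof.
move=> sL; apply/le_anti/andP; split; last exact: rearr_ge0.
rewrite leNgt; apply/negP; rewrite lt_rearr// => h.
have := lt_le_trans h (distribution_piece_le (lexx 0%R)).
by rewrite lte_fin ltNge sL.
Qed.

(** Both functions are equimeasurable after extension by 0, and the
    rearrangement of the piece vanishes beyond the length of the interval. *)
Lemma integral_rearr_piece :
  \int[leb]_(s in `]0%R, (b - a)%R[) w s = \int[leb]_(x in `[a, b[) f x.
Proof.
have -> : \int[leb]_(x in `[a, b[) f x = \int[leb]_(x in unit_itv) `|f1 x|.
  rewrite integral_mkcond [RHS]integral_mkcond; apply: eq_integral => x _.
  rewrite !patchE !mem_setE in_itv/= /f1 /glue; case: ifP => axb.
    have Ux : unit_itv x by apply: (ico_subset_unit a0 b1); rewrite /= in_itv.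
    by move: (Ux); rewrite /unit_itv /= => ->; rewrite gee0_abs// mf.2.
  by rewrite abse0; case: ifP.
rewrite -(@equimeasurable_integral R w) //; first last.
- by move=> t /ltW t0; exact: distribution_rearr.
- exact: measurable_rearr (@unit_interval R).
rewrite integral_mkcond [RHS]integral_mkcond; apply: eq_integral => s _.
rewrite !patchE !mem_setE !in_itv/= gee0_abs ?rearr_ge0//.
have [sL|sL] := ltP s (b - a)%R.
  rewrite (_ : (s < 1)%R)//; apply: (lt_le_trans sL).
  by rewrite lerBlDr (le_trans b1)// lerDl ltW.
by rewrite rearr_piece_eq0// andbF; case: ifP.
Qed.

Let mwa : measurable_fun `[a, b[ (fun x => w (x - a)%R).
Proof.
apply: antitone_measurable; first exact: interval_is_interval.
by move=> x y _ _ xy; apply: rearr_antitone; lra.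
Qed.

Lemma mplus_piece : mplus (glue a b (fun x => w (x - a)%R) f).
Proof. by apply: glue_mplus => // x _; exact: rearr_ge0. Qed.

(** Rearranging f inside the interval only leaves its distribution unchanged:
    there, the level sets become intervals starting at a. *)
Lemma ri_norm_rearr_piece : ri_norm X (glue a b (fun x => w (x - a)%R) f) = ri_norm X f.
Proof.
have fE : f = glue a b f f by apply/funext => x; rewrite /glue; case: ifP.
rewrite [in RHS]fE; apply: equimeasurable_ri_norm.
- exact: mplus_piece.1.
- by rewrite -fE; exact: mf.1.
- move=> t /ltW t0; apply: glue_equimeasurable => //.
  + exact: mplus_piece.1.
  + by rewrite -fE; exact: mf.1.
  rewrite -distribution_piece//.
  have dle := distribution_piece_le t0.
  have dge : 0 <= distribution_fun f1 t by exact: measure_ge0.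
  have dfin : distribution_fun f1 t \is a fin_num.
    by rewrite ge0_fin_numE// (le_lt_trans dle)// ltry.
  rewrite (_ : _ `&` _ = `[a, (a + fine (distribution_fun f1 t))%R[%classic).
    by rewrite lebesgue_length ?lerDl ?fine_ge0// addrAC subrr add0r fineK.
  apply/seteqP; split=> x /=; rewrite !in_itv/= gee0_abs ?rearr_ge0// lt_rearr//.
    by case=> /andP[-> xb] /=; rewrite -ltrBlDl -lte_fin fineK.
  move=> /andP[ax]; rewrite -ltrBlDl -lte_fin fineK// => h; split => //.
  by rewrite ax /=; have := lt_le_trans h dle; rewrite lte_fin; lra.
Qed.

(** On each block the decreasing function lies below its value at the left end
    point, that is, at the right end point of the preceding block. *)
Lemma integral_rearr_le_sum (d : R) (m : nat) : (0 < d)%R ->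
  \int[leb]_(s in `[d, (m.+1%:R * d)%R[) w s <= d%:E * \sum_(i < m) w (i.+1%:R * d)%R.
Proof.
move=> d0; elim: m => [|m IH].
  by rewrite mul1r set_itv_ge ?bnd_simp ?ltxx// integral_set0 big_ord0 mule0.
have h1 : (d <= m.+1%:R * d)%R by rewrite ler_peMl ?ler1n// ltW.
have h2 : (m.+1%:R * d <= m.+2%:R * d)%R by rewrite ler_pM2r// ler_nat.
rewrite (@itv_bndbnd_setU _ _ _ (BLeft (m.+1%:R * d)%R)) ?bnd_simp//.
rewrite ge0_integral_setU//=; first last.
- apply/disj_setPS => x [/=]; rewrite !in_itv/= => /andP[_ xl].
  by move=> /andP[/(lt_le_trans xl)]; rewrite ltxx.
- by move=> x _; exact: rearr_ge0.
- rewrite -itv_bndbnd_setU ?bnd_simp//.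
  by apply: measurable_rearr; exact: interval_is_interval.
rewrite big_ord_recr/= ge0_muleDr;
  [|by apply: sume_ge0 => i _; exact: rearr_ge0|exact: rearr_ge0].
apply: leeD => //.
have -> : d%:E * w (m.+1%:R * d) =
    \int[leb]_(s in `[(m.+1%:R * d)%R, (m.+2%:R * d)%R[) cst (w (m.+1%:R * d)) s.
  rewrite integral_cst//= lebesgue_length// muleC; congr (_ * _%:E).
  by rewrite -[(m.+2)%:R]natr1; ring.
apply: ge0_le_integral => //.
- by move=> s _; exact: rearr_ge0.
- by apply: measurable_rearr; exact: interval_is_interval.
- by move=> s /=; rewrite in_itv/= => /andP[h _]; exact: rearr_antitone.
Qed.

Let cut (n : nat) := `[((b - a) / n.+1%:R)%R, (b - a)%R[%classic.

(** The rearranged piece dominates the step function taking on each block its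
    value at the right end point; the mean of these values is at least the mean
    of the rearrangement with the first block removed. *)
Lemma ri_norm_cut n :
  ri_norm X (glue a b (cst (((b - a)^-1)%:E * \int[leb]_(s in cut n) w s)) f)
  <= ri_norm X f.
Proof.
set d := ((b - a) / n.+1%:R)%R.
have d0 : (0 < d)%R by rewrite divr_gt0.
have dn : (n.+1%:R * d = b - a)%R by rewrite mulrC divfK// pnatr_eq0.
pose al (i : 'I_n.+1) := w (i.+1%:R * d)%R.
have al0 i : 0 <= al i by exact: rearr_ge0.
apply: (@le_trans _ _ (ri_norm X (glue a b (cst ((n.+1%:R^-1)%:E * \sum_(i < n.+1) al i)) f))).
  apply: ri_norm_le.
  - by apply: glue_measurable mf.1; exact: measurable_cst.
  - by apply: glue_measurable mf.1; exact: measurable_cst.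
  move=> x _; rewrite /glue; case: ifP => // _.
  have S0 : 0 <= \sum_(i < n.+1) al i by apply: sume_ge0.
  have I0 : 0 <= \int[leb]_(s in cut n) w s by apply: integral_ge0 => s _; exact: rearr_ge0.
  have L0' : 0 <= ((b - a)^-1)%:E by rewrite lee_fin invr_ge0 ltW.
  rewrite !gee0_abs; [|exact: mule_ge0|by rewrite mule_ge0// lee_fin invr_ge0].
  rewrite lee_pdivrMl// muleA -EFinM -[in X in _ <= X]dn [(_ * d)%R]mulrC mulfK ?pnatr_eq0//.
  rewrite /cut -/d -[in X in `[_, X[]dn; apply: le_trans (integral_rearr_le_sum n d0) _.
  rewrite lee_pmul2l// big_ord_recr/= leeDl// rearr_ge0//.
apply: le_trans (ri_norm_block_average mf al0) _.
rewrite -ri_norm_rearr_piece; apply: ri_norm_le.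
- by apply: glue_measurable mf.1; exact: measurable_block.
- exact: mplus_piece.1.
move=> x _; rewrite /glue; case: ifP => // axb.
rewrite !gee0_abs ?rearr_ge0//; apply: rearr_antitone.
have := blockP ab (block a b n x) axb; rewrite eqxx -/d => /esym/andP[_].
by lra.
Qed.

(** The means in [ri_norm_cut] increase to the mean of f as the blocks shrink, and
    the Fatou property concludes. *)
Lemma ri_norm_average :
  ri_norm X (glue a b (cst (((b - a)^-1)%:E * \int[leb]_(x in `[a, b[) f x)) f)
  <= ri_norm X f.
Proof.
pose c n := ((b - a)^-1)%:E * \int[leb]_(s in cut n) w s.
have c0 n : 0 <= c n.
  apply: mule_ge0; first by rewrite lee_fin invr_ge0 ltW.
  by apply: integral_ge0 => s _; exact: rearr_ge0.
have cutU : \bigcup_n cut n = `]0%R, (b - a)%R[%classic.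
  apply/seteqP; split=> s.
    move=> [n _]; rewrite /cut /= !in_itv/= => /andP[h ->].
    by rewrite (lt_le_trans _ h)// divr_gt0.
  rewrite /= in_itv/= => /andP[s0 sL]; have : (0 < s / (b - a))%R by rewrite divr_gt0.
  move=> /ltr_add_invr[n]; rewrite add0r ltr_pdivlMr// => hn.
  by exists n => //; rewrite /cut /= in_itv/= sL andbT mulrC ltW.
have ndcut : nondecreasing_seq cut.
  move=> m n mn; apply/subsetPset => s; rewrite /cut /= !in_itv/= => /andP[h ->].
  by rewrite andbT (le_trans _ h)// ler_pM2l// lef_pV2 ?posrE// ler_nat.
have mcut n : measurable (cut n) by exact: measurable_itv.
have mw n : measurable_fun (cut n) w.
  by apply: measurable_rearr; exact: interval_is_interval.
have ndc : nondecreasing_seq c.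
  move=> m n mn; rewrite /c lee_pmul2l ?lte_fin ?invr_gt0//.
  apply: (@ge0_subset_integral _ _ _ leb (cut m) (cut n) (mcut m) (mcut n) w (mw n)) => [s _|].
    exact: rearr_ge0.
  by apply/subsetPset; exact: ndcut.
have cvc : c @ \oo --> ((b - a)^-1)%:E * \int[leb]_(x in `[a, b[) f x.
  apply: cvgeZl => //; rewrite -integral_rearr_piece -cutU.
  apply: ge0_nondecreasing_set_cvg_integral => //.
  by move=> n s _; exact: rearr_ge0.
apply: (@ri_norm_lim_le _ X (fun n => glue a b (cst (c n)) f)).
- by move=> n; apply: glue_mplus => // x _; exact: c0.
- apply: glue_mplus => // x _; apply: mule_ge0; first by rewrite lee_fin invr_ge0 ltW.
  apply: integral_ge0 => s /= Is; apply: mf.2.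
  exact: (ico_subset_unit a0 b1).
- move=> x _; rewrite /glue; case: ifP => _; first by split.
  by split => //; exact: cvg_cst.
- exact: ri_norm_cut.
Qed.
End Average.

(** * Averages and dilations along an N-adic partition *)

Section Adic.
Variables (R : realType) (X : ri_space R) (n : nat).
Hypothesis n0 : (0 < n)%N.

Let q : R := (n.+1%:R^-1)%R.
Let q0 : (0 < q)%R. Proof. by rewrite invr_gt0. Qed.
Let q1 : (q < 1)%R. Proof. by rewrite invf_lt1// ltr1n. Qed.
Let qn : (n.+1%:R * q = 1)%R. Proof. by rewrite mulfV// pnatr_eq0. Qed.

(** With N = n+1, the intervals [N^-(m+1), N^-m[ partition (0,1). *)
Definition adic (m : nat) : set R := `[(n.+1%:R^-1 ^+ m.+1)%R, (n.+1%:R^-1 ^+ m)%R[.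

Definition adic_level (x : R) : nat := xget 0%N [set m | adic m x].

Definition adic_step (c : nat -> \bar R) (x : R) : \bar R := c (adic_level x).

Lemma adicP m x : adic m x <-> (q ^+ m.+1 <= x < q ^+ m)%R.
Proof. by rewrite /adic /= in_itv. Qed.

Lemma adic_lt m : (q ^+ m.+1 < q ^+ m)%R.
Proof. by rewrite exprS gtr_pMl// exprn_gt0. Qed.

Lemma adic_gt0 m : (0 < n.+1%:R^-1 ^+ m :> R)%R.
Proof. by rewrite exprn_gt0. Qed.

Lemma adic_le1 m : (n.+1%:R^-1 ^+ m <= 1 :> R)%R.
Proof. by rewrite exprn_ile1// ltW. Qed.

Lemma adic_unit m : adic m `<=` unit_itv.
Proof. by apply: ico_subset_unit; [exact: adic_gt0|exact: adic_le1]. Qed.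

Lemma adic_inj m k x : adic m x -> adic k x -> m = k.
Proof.
move=> /adicP/andP[m1 m2] /adicP/andP[k1 k2].
have : (q ^+ m.+1 < q ^+ k)%R by exact: le_lt_trans m1 k2.
have : (q ^+ k.+1 < q ^+ m)%R by exact: le_lt_trans k1 m2.
by rewrite !ltr_iXn2l// !ltnS => h1 h2; apply/eqP; rewrite eqn_leq h1 h2.
Qed.

Lemma adic_levelP m x : adic m x -> adic_level x = m.
Proof.
move=> mx; apply: (@adic_inj _ _ x) => //.
by apply: (@xgetPex _ 0%N [set m | adic m x]); exists m.
Qed.

Lemma adic_level_mem x : unit_itv x -> adic (adic_level x) x.
Proof.
move=> /unit_itvP/andP[x0 x1].
suff : exists m, adic m x by move=> H; apply: (@xgetPex _ 0%N [set m | adic m x]).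
have ex : exists m, (q ^+ m <= x)%R.
  have [m hm] : exists m : nat, (x^-1 < m%:R)%R.
    by exists (Num.bound x^-1); rewrite archi_boundP// invr_ge0 ltW.
  exists m; rewrite -[x]invrK -[(q ^+ m)%R]invrK lef_pV2 ?posrE ?invr_gt0 ?exprn_gt0//.
  apply: ltW; apply: (lt_le_trans hm); rewrite /q exprVn invrK -natrX ler_nat.
  by apply: ltnW; apply: ltn_expl.
case: (ex_minnP ex) => -[|m] hm min; first by move: hm; rewrite expr0 leNgt x1.
exists m; apply/adicP; rewrite hm ltNge; apply/negP => /min.
by rewrite ltnn.
Qed.

Lemma measurable_adic m : measurable (adic m).
Proof. exact: measurable_itv. Qed.

(** Measurability can be checked on each interval of the partition, where the
    level is constant. *)
Lemma measurable_adic_level (T : nat -> R -> \bar R) :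
  (forall m, measurable_fun (adic m) (T m)) ->
  measurable_fun unit_itv (fun x => T (adic_level x) x).
Proof.
move=> mT _ B mB.
rewrite (_ : _ `&` _ = \bigcup_m (adic m `&` T m @^-1` B)).
  apply: bigcup_measurable => m _; apply: mT => //; exact: measurable_adic.
apply/seteqP; split=> x.
  by move=> [Ux Bx]; exists (adic_level x) => //; split => //; exact: adic_level_mem.
move=> [m _ [mx Bx]]; split; first exact: adic_unit mx.
by rewrite /= (adic_levelP mx).
Qed.

Lemma adic_step_mplus (c : nat -> \bar R) : (forall m, 0 <= c m) -> mplus (adic_step c).
Proof.
move=> c0; split; last by move=> x _; exact: c0.
by apply: (measurable_adic_level (T := fun m x => c m)) => m; exact: measurable_cst.
Qed.

(** Dilation by N, for functions constant on the intervals of the partition.  The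
    m-th interval is made of N blocks, each as long as the (m+1)-st interval;
    keeping one block out of each interval gives N functions, all equimeasurable
    with the restriction of the step function of c to the levels m > 0. *)
Lemma ri_norm_adic_shift (c : nat -> \bar R) : (forall m, 0 <= c m) ->
  ri_norm X (adic_step (fun m => c m.+1)) <= (n.+1%:R)%:E * ri_norm X (adic_step c).
Proof.
move=> c0.
(* G is the step function of c with its first interval set to 0; F j keeps the
   j-th block of each interval, with the next value of c. *)
pose blk m x := block (n.+1%:R^-1 ^+ m.+1 : R) (n.+1%:R^-1 ^+ m) n x.
pose F (j : 'I_n.+1) x := if blk (adic_level x) x == j then c (adic_level x).+1 else 0.
pose G x := if adic_level x == 0%N then 0 else c (adic_level x).
have mF j : mplus (F j).
  split; last by move=> x _; rewrite /F; case: ifP.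
  apply: (measurable_adic_level (T := fun m x => if blk m x == j then c m.+1 else 0)) => m.
  exact: (measurable_block (fun i => if i == j then c m.+1 else 0) (adic_lt m)).
have mG : mplus G.
  split; last by move=> x _; rewrite /G; case: ifP.
  apply: (measurable_adic_level (T := fun m x => if m == 0%N then 0 else c m)) => m.
  exact: measurable_cst.
have FG j : ri_norm X (F j) = ri_norm X G.
  apply: equimeasurable_ri_norm; [exact: (mF _).1|exact: mG.1|move=> t t0].
  pose P : set nat := [set m | t%:E < `|c m.+1|].
  pose a m : R := (q ^+ m.+1)%R; pose d m := ((q ^+ m - q ^+ m.+1) / n.+1%:R)%R.
  pose J m := `[(a m + j%:R * d m)%R, (a m + j.+1%:R * d m)%R[%classic.
  have JE m x : J m x <-> adic m x /\ blk m x = j.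
    have := block_set (adic_lt m) (set1 j); rewrite bigcup_set1 => /seteqP[h1 h2].
    by split => h; [exact: h2|exact: h1].
  have FE : [set x | unit_itv x /\ t%:E < `|F j x|] = \bigcup_(m in P) J m.
    apply/seteqP; split=> x.
      move=> [Ux]; rewrite /F; case: eqP => [bj Pm|_]; last first.
        by rewrite abse0 lte_fin ltNge ltW.
      by exists (adic_level x) => //; apply/JE; split => //; exact: adic_level_mem.
    move=> [m Pm /JE[mx bj]]; split; first exact: adic_unit mx.
    by rewrite /F (adic_levelP mx) bj eqxx.
  have GE : [set x | unit_itv x /\ t%:E < `|G x|] = \bigcup_(m in P) adic m.+1.
    apply/seteqP; split=> x.
      move=> [Ux]; have := adic_level_mem Ux; rewrite /G.
      case: (adic_level x) => [|m] mx.
        by rewrite eqxx abse0 lte_fin ltNge ltW.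
      by move=> Pm; exists m.
    move=> [m Pm mx]; split; first exact: adic_unit mx.
    by rewrite /G (adic_levelP mx).
  have d0 m : (0 < d m)%R by rewrite divr_gt0// subr_gt0 adic_lt.
  rewrite /distribution_fun FE GE !measure_bigcup.
  - apply: eq_eseriesr => m _; apply: (etrans (lebesgue_length _)).
      by rewrite lerD2l ler_pM2r// ler_nat.
    apply/esym/(etrans (lebesgue_length (ltW (adic_lt _)))); congr EFin.
    rewrite -[(j.+1)%:R]natr1 /d -/q !exprS /q; by field; rewrite nat1r pnatr_eq0.
  - by move=> m _; exact: measurable_adic.
  - by move=> m k _ _ [x [mx kx]]; have := adic_inj mx kx => -[].
  - by move=> m _; exact: measurable_itv.
  - by move=> m k _ _ [x [/JE[mx _] /JE[kx _]]]; exact: adic_inj mx kx.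
have mS := adic_step_mplus (fun m => c0 m.+1).
rewrite (@eq_ri_norm _ X _ (fun x => \sum_(j < n.+1) F (inord j) x)) //; first last.
- move=> x Ux; congr (`|_|); under eq_bigr do rewrite inord_val.
  rewrite /F -big_mkcond/=; under eq_bigl do rewrite eq_sym.
  by rewrite big_pred1_eq.
- by apply: emeasurable_sum => j; exact: (mF _).1.
- exact: mS.1.
apply: le_trans (ri_norm_sum X n.+1 (fun j => mF (inord j))) _.
under eq_bigr do rewrite FG.
rewrite sume_cst; last exact: ri_norm_ge0 mG.1.
rewrite lee_pmul2l// ?lte_fin ?ltr0n//.
apply: ri_norm_le; [exact: mG.1|exact: (adic_step_mplus c0).1|].
by move=> x _; rewrite /G /adic_step; case: ifP => // _; rewrite abse0.
Qed.

Lemma ri_norm_adic_shiftn (c : nat -> \bar R) (j : nat) : (forall m, 0 <= c m) ->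
  ri_norm X (adic_step (fun m => c (m + j)%N)) <=
  (n.+1%:R ^+ j)%:E * ri_norm X (adic_step c).
Proof.
elim: j c => [|j IH] c c0.
  by rewrite expr0 mul1e; under [X in adic_step X]eq_fun do rewrite addn0.
under [X in adic_step X]eq_fun do rewrite addnS.
apply: le_trans (ri_norm_adic_shift (c := fun m => c (m + j)%N) _) _ => //.
by rewrite exprS EFinM -muleA lee_pmul2l ?lte_fin ?ltr0n//; exact: IH.
Qed.

Definition adic_avg (f : R -> \bar R) (m : nat) : \bar R :=
  ((n.+1%:R^-1 ^+ m - n.+1%:R^-1 ^+ m.+1)^-1)%:E * \int[leb]_(x in adic m) f x.

Lemma adic_avg_ge0 f m : mplus f -> 0 <= adic_avg f m.
Proof.
move=> mf; apply: mule_ge0; first by rewrite lee_fin invr_ge0 subr_ge0 ltW// adic_lt.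
by apply: integral_ge0 => x mx; apply: mf.2; exact: adic_unit mx.
Qed.

(** The conditional expectation on the partition is a contraction: average over
    the first M intervals one after the other, and let M tend to infinity. *)
Lemma ri_norm_adic_avg (f : R -> \bar R) : mplus f ->
  ri_norm X (adic_step (adic_avg f)) <= ri_norm X f.
Proof.
move=> mf; pose c := adic_avg f; have c0 m : 0 <= c m by exact: adic_avg_ge0.
pose fM (M : nat) x := if (adic_level x < M)%N then c (adic_level x) else f x.
have mfM M : mplus (fM M).
  split; last by move=> x Ux; rewrite /fM; case: ifP => // _; exact: mf.2.
  apply: (measurable_adic_level (T := fun m x => if (m < M)%N then c m else f x)) => m.
  case: (m < M)%N; first exact: measurable_cst.
  exact: (measurable_funS (@measurable_unit R) (@adic_unit m) mf.1).
have le M : ri_norm X (fM M) <= ri_norm X f.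
  elim: M => [|M IH]; first by apply: ri_norm_le => //; [exact: (mfM _).1|exact: mf.1].
  apply: le_trans IH.
  apply: le_trans (ri_norm_average X (adic_gt0 _) (adic_lt M) (adic_le1 _) (mfM M)).
  have -> : \int[leb]_(x in `[(n.+1%:R^-1 ^+ M.+1)%R, (n.+1%:R^-1 ^+ M)%R[) fM M x =
      \int[leb]_(x in adic M) f x.
    apply: eq_integral => y; rewrite inE => My.
    by rewrite /fM (adic_levelP My) ltnn.
  apply: ri_norm_le; [exact: (mfM _).1| |].
    by apply: glue_measurable (mfM M).1; exact: measurable_cst.
  move=> x Ux; rewrite /glue; case: ifPn => [h|/negP h].
    have mx : adic M x by apply/adicP.
    by rewrite /fM (adic_levelP mx) ltnSn.
  rewrite /fM ltnS leq_eqVlt; case: eqP => //= lM.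
  by case: h; apply/adicP; rewrite -lM; exact: adic_level_mem.
apply: (@ri_norm_lim_le _ X (fun M x => if (adic_level x < M)%N then c (adic_level x) else 0)).
- move=> M; apply: (adic_step_mplus (c := fun m => if (m < M)%N then c m else 0)) => m.
  by case: ifP.
- exact: adic_step_mplus.
- move=> x Ux; split.
    move=> M M' MM'; case: ifP => h; last by case: ifP.
    by rewrite (leq_trans h MM').
  apply: cvg_near_cst; exists (adic_level x).+1 => // M /= h.
  by rewrite h.
- move=> M; apply: le_trans (le M); apply: ri_norm_le; [|exact: (mfM _).1|].
    apply: (adic_step_mplus (c := fun m => if (m < M)%N then c m else 0) _).1 => m.
    by case: ifP.
  by move=> x Ux; rewrite /fM; case: ifP => // _; rewrite abse0.
Qed.

End Adic.

(** * The class A0 and a weighted Hardy operator *)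

Lemma dilation_ge (R : realType) (psi : R -> R) (s t : R) : class_A0 psi ->
  (0 < s < 1)%R -> (0 < t)%R -> (s * t < 1)%R ->
  (psi (s * t) <= fine (dilation_fun psi t) * psi s)%R.
Proof.
move=> hpsi s01 t0 st1.
have Us : unit_itv s by apply/unit_itvP.
have psis := A0_pos hpsi Us.
have h : (psi (s * t) / psi s)%:E <= dilation_fun psi t.
  by apply: ereal_sup_ubound; exists s.
have := A0_fin hpsi t0.
rewrite -ler_pdivrMr//; move: h; case: (dilation_fun psi t) => [x||]//.
Qed.

(** Comparing t with t/2 < 1/2 bounds psi(t) by m(2) psi(1/2). *)
Lemma A0_bounded (R : realType) (psi : R -> R) : class_A0 psi ->
  exists2 M : R, (0 < M)%R & forall t, unit_itv t -> (psi t <= M)%R.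
Proof.
move=> hpsi; pose M := (`|fine (dilation_fun psi 2)| * psi 2^-1 + 1)%R.
have U2 : unit_itv (2^-1 : R)%R by apply/unit_itvP; lra.
have p2 := A0_pos hpsi U2.
exists M; first by rewrite ltr_wpDl// mulr_ge0// ltW.
move=> t /unit_itvP t01.
have := @dilation_ge _ psi (t / 2) 2 hpsi; rewrite divfK// => H.
have {}H := H ltac:(lra) ltac:(lra) ltac:(lra).
apply: (le_trans H); rewrite /M.
have Ut2 : unit_itv (t / 2)%R by apply/unit_itvP; lra.
have pt2 := A0_pos hpsi Ut2.
have le2 : (psi (t / 2) <= psi 2^-1)%R by apply: (A0_incr hpsi) => //; lra.
apply: ler_wpDr => //.
apply: (@le_trans _ _ (`|fine (dilation_fun psi 2)| * psi (t / 2))%R).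
  by rewrite ler_wpM2r ?ler_norm// ltW.
by rewrite ler_wpM2l.
Qed.

(** What a positive lower index means: for t small the quotient
    log m(t) / log t is positive, hence m(t) < 1, and one may take t = 1/N. *)
Lemma A0_contraction (R : realType) (psi : R -> R) : class_A0 psi ->
  exists n : nat, exists q : R, [/\ (0 < n)%N, (0 < q < 1)%R &
    forall t u : R, unit_itv t -> (0 < u)%R -> (u <= n.+1%:R^-1 * t)%R ->
      (psi u <= q * psi t)%R].
Proof.
move=> hpsi; have [bl [bu [low _ bl0 _ _]]] := A0_index hpsi.
have [e /= e0 He] : \forall t \near (0%R : R)^'+,
    (0 < ln (fine (dilation_fun psi t)) / ln t)%R.
  exact: (cvgr_gt bl low 0%R bl0).
have [k hk] : exists k : nat, (e^-1 < k%:R)%R.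
  by exists (Num.bound e^-1); rewrite archi_boundP// invr_ge0 ltW.
pose n := k.+1; pose th : R := (n.+1%:R^-1)%R.
have th0 : (0 < th)%R by rewrite invr_gt0.
have th1 : (th < 1)%R by rewrite invf_lt1// ltr1n.
have the : (th < e)%R.
  rewrite -[e]invrK ltf_pV2 ?posrE ?invr_gt0//; apply: (lt_le_trans hk).
  by rewrite ler_nat; do 2 apply: leqW.
have lnth : (ln th < 0)%R by apply: ln_lt0; rewrite th0.
have D1 : (fine (dilation_fun psi th) < 1)%R.
  rewrite ltNge; apply/negP => /ln_ge0 h.
  have := He th; rewrite /= sub0r normrN gtr0_norm// => /(_ the th0).
  by rewrite ltNge => /negP; apply; rewrite mulr_ge0_le0// invr_le0 ltW.
(* The maximum with 1/2 makes the ratio positive. *)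
exists n, (Num.max (fine (dilation_fun psi th)) 2^-1)%R; split => //.
  by rewrite lt_max gt_max D1 /=; lra.
move=> t u Ut u0 uth; have /unit_itvP/andP[t0 t1] := Ut.
have th_t : (t * th < t)%R by rewrite gtr_pMr.
have tht0 : (0 < t * th)%R by rewrite mulr_gt0.
apply: (@le_trans _ _ (psi (t * th)%R)).
  apply: (A0_incr hpsi); [apply/unit_itvP|apply/unit_itvP|by rewrite mulrC].
    by rewrite u0 /=; rewrite mulrC in uth; rewrite (le_lt_trans uth)// (lt_trans th_t).
  by rewrite tht0 (lt_trans th_t).
apply: (le_trans (dilation_ge hpsi _ th0 _)); [by rewrite t0|by rewrite (lt_trans th_t)|].
by rewrite ler_wpM2r ?le_max ?lexx// ltW// (A0_pos hpsi).
Qed.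

Lemma A0_contraction_pow (R : realType) (psi : R -> R) (n : nat) (q : R) :
  class_A0 psi -> (0 < q)%R ->
  (forall t u : R, unit_itv t -> (0 < u)%R -> (u <= n.+1%:R^-1 * t)%R ->
      (psi u <= q * psi t)%R) ->
  forall (j : nat) (t u : R), unit_itv t -> (0 < u)%R -> (u <= n.+1%:R^-1 ^+ j * t)%R ->
      (psi u <= q ^+ j * psi t)%R.
Proof.
move=> hpsi q0 H; elim=> [|j IH] t u Ut u0.
  rewrite expr0 !mul1r => ut; apply: (A0_incr hpsi) => //.
  by apply/unit_itvP; move/unit_itvP : Ut => /andP[_ /(le_lt_trans ut) ->]; rewrite u0.
have /unit_itvP/andP[t0 t1] := Ut.
have th0 : (0 < n.+1%:R^-1 ^+ j :> R)%R by rewrite exprn_gt0// invr_gt0.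
have th1 : (n.+1%:R^-1 ^+ j <= 1 :> R)%R.
  by rewrite exprn_ile1// ?invr_ge0// invf_le1// ler1n.
rewrite exprS -mulrA => ut.
have v0 : (0 < n.+1%:R^-1 ^+ j * t)%R by rewrite mulr_gt0.
have Uv : unit_itv (n.+1%:R^-1 ^+ j * t)%R.
  by apply/unit_itvP; rewrite v0 (le_lt_trans _ t1)// ler_piMl// ltW.
apply: (le_trans (H _ _ Uv u0 ut)).
rewrite exprS -mulrA; apply: ler_wpM2l; first exact: ltW. exact: IH.
Qed.

Definition hardy (R : realType) (psi : R -> R) (k : R -> \bar R) (t : R) : \bar R :=
  ((t * psi t)^-1)%:E * \int[leb]_(u in `]0%R, t[) ((psi u)%:E * k u).

Lemma measurable_A0 (R : realType) (psi : R -> R) : class_A0 psi ->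
  measurable_fun unit_itv (fun u => (psi u)%:E).
Proof.
move=> hpsi; apply: monotone_measurable; first exact: unit_interval.
by move=> x y Ux Uy xy; rewrite lee_fin; exact: (A0_incr hpsi).
Qed.

Lemma measurable_primitive (R : realType) (g : R -> \bar R) : mplus g ->
  measurable_fun unit_itv (fun t => \int[leb]_(u in `]0%R, t[) g u).
Proof.
move=> [mg g0]; apply: monotone_measurable; first exact: unit_interval.
move=> x y _ /unit_itvP/andP[_ /ltW y1] xy.
have sub := oo_subset_unit y1.
apply: (@ge0_subset_integral _ _ _ leb `]0%R, x[ `]0%R, y[
  (measurable_itv _) (measurable_itv _) g
  (measurable_funS (@measurable_unit R) sub mg)) => [u /sub/g0//|].
by move=> u /=; rewrite !in_itv/= => /andP[-> /lt_le_trans]; exact.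
Qed.

Lemma hardy_mplus (R : realType) (psi : R -> R) (k : R -> \bar R) :
  class_A0 psi -> mplus k -> mplus (hardy psi k).
Proof.
move=> hpsi mk.
have mpk : mplus (fun u => (psi u)%:E * k u).
  split; first by apply: emeasurable_funM; [exact: measurable_A0|exact: mk.1].
  by move=> x Ux; rewrite mule_ge0 ?mk.2// lee_fin ltW// (A0_pos hpsi).
split.
  apply: emeasurable_funM; last exact: measurable_primitive.
  apply: antitone_measurable; first exact: unit_interval.
  move=> x y Ux Uy xy; rewrite lee_fin.
  have px := A0_pos hpsi Ux; have py := A0_pos hpsi Uy.
  have /unit_itvP/andP[x0 _] := Ux; have /unit_itvP/andP[y0 _] := Uy.
  rewrite lef_pV2 ?posrE ?mulr_gt0//; apply: ler_pM => //; try exact: ltW.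
  exact: (A0_incr hpsi).
move=> t Ut; have /unit_itvP/andP[t0 t1] := Ut; apply: mule_ge0.
  by rewrite lee_fin invr_ge0 mulr_ge0 ?ltW// (A0_pos hpsi).
by apply: integral_ge0 => u /(oo_subset_unit (ltW t1)) /mpk.2.
Qed.

(** A geometric series, plus 1 because the terms j = 0 and j = 1 both have
    exponent 0. *)
Lemma sum_pred_expr_le (R : realType) (q : R) n : (0 < q < 1)%R ->
  (\sum_(j < n) q ^+ j.-1 <= 1 + (1 - q)^-1)%R.
Proof.
move=> /andP[q0 q1]; have q1' : (0 < (1 - q)^-1)%R by rewrite invr_gt0 subr_gt0.
case: n => [|n]; first by rewrite big_ord0; lra.
suff -> : (\sum_(j < n.+1) q ^+ j.-1 = 1 + (1 - q ^+ n) * (1 - q)^-1)%R.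
  rewrite lerD2l ler_piMl ?ltW// gtrBl exprn_gt0//.
elim: n => [|n IH]; first by rewrite big_ord1 expr0; ring.
rewrite big_ord_recr IH /= exprS; field.
by rewrite subr_eq0 gt_eqF.
Qed.

(** For t in the m-th interval, the integral over (0,t) is split along the
    intervals of level m + j.  There psi <= q^(j-1) psi(t) if j > 0, and
    psi <= psi(t) on (0,t) in any case, while the length of the interval is at
    most N t N^-j; so P_psi k is bounded by the sum over j of
    N q^(j-1) N^-j times the step function of the averages of k, shifted by j.
    The shift costs a factor N^j, averaging costs nothing, and a geometric
    series in q remains. *)
Lemma hardy_bounded (R : realType) (X : ri_space R) (psi : R -> R) : class_A0 psi ->
  exists2 C : R, (0 < C)%R &
    forall k, mplus k -> ri_norm X (hardy psi k) <= C%:E * ri_norm X k.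
Proof.
move=> hpsi; have [n [q [n0 q01 H]]] := A0_contraction hpsi.
have /andP[q0 q1] := q01.
have {}H := A0_contraction_pow hpsi q0 H.
pose th : R := (n.+1%:R^-1)%R.
have th0 : (0 < th)%R by rewrite invr_gt0.
have th1 : (th <= 1)%R by rewrite invf_le1// ler1n.
have thn : (n.+1%:R * th = 1)%R by rewrite mulfV// pnatr_eq0.
exists (n.+1%:R * (1 + (1 - q)^-1))%R.
  by rewrite mulr_gt0// addr_gt0// invr_gt0 subr_gt0.
move=> k mk; pose c := adic_avg n k.
have c0 m : 0 <= c m by exact: adic_avg_ge0.
pose a j : R := (q ^+ j.-1 * n.+1%:R * th ^+ j)%R.
have a0 j : (0 <= a j)%R by rewrite !mulr_ge0// exprn_ge0// ltW.
have mS j : mplus (adic_step n (fun m => c (m + j)%N)).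
  by apply: adic_step_mplus.
pose u j x := (a j)%:E * adic_step n (fun m => c (m + j)%N) x.
have mu j : mplus (u j).
  split; last by move=> x Ux; rewrite mule_ge0 ?lee_fin// (mS j).2.
  by apply: emeasurable_funM; [exact: measurable_cst|exact: (mS j).1].
apply: (@le_trans _ _ (ri_norm X (fun x => \sum_(j <oo) u j x))).
  apply: ri_norm_le; [exact: (hardy_mplus hpsi mk).1| |].
    apply: ge0_emeasurable_sum => [j x Ux _|j _]; [exact: (mu j).2|exact: (mu j).1].
  move=> t Ut; rewrite !gee0_abs; first last.
  - exact: (hardy_mplus hpsi mk).2.
  - by apply: nneseries_ge0 => j _ _; exact: (mu j).2.
  have /unit_itvP/andP[t0 t1] := Ut; have pt := A0_pos hpsi Ut.
  pose m := adic_level n t.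
  have /adicP/andP[mt1 mt2] : adic n m t by exact: adic_level_mem.
  (* The predecessor accounts for t itself lying anywhere in its interval: a point
     of level m + j is below N^(1-j) t only. *)
  pose g v := (psi t * q ^+ (adic_level n v - m).-1)%:E * k v.
  have w0 i : (0 <= psi t * q ^+ i)%R by rewrite mulr_ge0 ?exprn_ge0// ltW.
  have mg : mplus g.
    split; last by move=> v Uv; rewrite mule_ge0 ?mk.2// lee_fin.
    apply: (measurable_adic_level n0
      (T := fun l v => (psi t * q ^+ (l - m).-1)%:E * k v)) => l.
    apply: emeasurable_funM; first exact: measurable_cst.
    exact: (measurable_funS (@measurable_unit R) (@adic_unit R n n0 l) mk.1).
  have int_g j : \int[leb]_(v in adic n (m + j)%N) g v =
      (psi t * q ^+ j.-1 * (th ^+ (m + j)%N - th ^+ (m + j)%N.+1))%:E * c (m + j)%N.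
    have dj : (0 < th ^+ (m + j)%N - th ^+ (m + j)%N.+1)%R by rewrite subr_gt0 adic_lt.
    have cE : (th ^+ (m + j)%N - th ^+ (m + j)%N.+1)%:E * c (m + j)%N =
        \int[leb]_(v in adic n (m + j)%N) k v.
      by rewrite /c /adic_avg muleA -EFinM -/th mulfV ?mul1e// gt_eqF.
    rewrite EFinM -muleA cE.
    rewrite -(@ge0_integralZl _ _ _ leb _ (@measurable_adic R n (m + j)%N) k)//.
    - by apply: eq_integral => v; rewrite inE => mv; rewrite /g (adic_levelP n0 mv) addKn.
    - exact: (measurable_funS (@measurable_unit R) (@adic_unit R n n0 _) mk.1).
    - by move=> v /(adic_unit n0)/mk.2.
    - by rewrite lee_fin.
  have le_g v : `]0%R, t[%classic v -> (psi v)%:E * k v <= g v.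
    move=> tv; have Uv := oo_subset_unit (ltW t1) tv.
    move: tv; rewrite /= in_itv/= => /andP[v0 vt].
    apply: lee_wpmul2r; first exact: mk.2.
    rewrite lee_fin mulrC; apply: H => //.
    have /adicP/andP[_ v2] := adic_level_mem n0 Uv.
    have [lm|ml] := leqP (adic_level n v) m.
      have -> : (adic_level n v - m = 0)%N by apply/eqP; rewrite subn_eq0.
      by rewrite expr0 mul1r ltW.
    apply: (le_trans (ltW v2)); rewrite -{1}(subnK (ltnW ml)).
    have : (0 < adic_level n v - m)%N by rewrite subn_gt0.
    case: (adic_level n v - m)%N => // i _; rewrite /= addSnnS exprD.
    by rewrite ler_wpM2l// exprn_ge0// ltW.
  have sub : `]0%R, t[ `<=` \bigcup_j adic n (m + j)%N.
    move=> v tv; have Uv := oo_subset_unit (ltW t1) tv.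
    move: tv; rewrite /= in_itv/= => /andP[v0 vt].
    exists (adic_level n v - m)%N => //.
    have mv := adic_level_mem n0 Uv; rewrite subnKC//.
    move: mv => /adicP/andP[v1 _]; rewrite leqNgt; apply/negP => lm.
    have := lt_trans vt mt2; rewrite ltNge => /negP; apply; apply: le_trans v1.
    exact: (ler_wiXn2l (ltW th0) th1 lm).
  have mpk : measurable_fun unit_itv (fun u => (psi u)%:E * k u).
    by apply: emeasurable_funM; [exact: measurable_A0|exact: mk.1].
  have unitD : \bigcup_j adic n (m + j)%N `<=` @unit_itv R.
    by move=> v [j _]; exact: adic_unit.
  apply: (@le_trans _ _ (((t * psi t)^-1)%:E *
      \sum_(j <oo) \int[leb]_(v in adic n (m + j)%N) g v)).
    apply: lee_wpmul2l; first by rewrite lee_fin invr_ge0 mulr_ge0// ltW.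
    have mD : measurable (\bigcup_j adic n (m + j)%N : set R).
      by apply: bigcup_measurable => j _; exact: measurable_adic.
    rewrite -ge0_integral_bigcup.
    - apply: (@le_trans _ _ (\int[leb]_(v in `]0%R, t[) g v)).
        apply: ge0_le_integral => //.
        + move=> v /(oo_subset_unit (ltW t1)) Uv; rewrite mule_ge0 ?mk.2//.
          by rewrite lee_fin ltW// (A0_pos hpsi).
        + exact: (measurable_funS (@measurable_unit R) (oo_subset_unit (ltW t1)) mpk).
        + exact: (measurable_funS (@measurable_unit R) (oo_subset_unit (ltW t1)) mg.1).
      apply: (@ge0_subset_integral _ _ _ leb _ _ (measurable_itv _) mD g) => //.
        exact: (measurable_funS (@measurable_unit R) unitD mg.1).
      by move=> v /unitD/mg.2.
    - by move=> j; exact: measurable_adic.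
    - exact: (measurable_funS (@measurable_unit R) unitD mg.1).
    - by move=> v /unitD/mg.2.
    - by move=> i j _ _ [v [mi mj]]; have := adic_inj n0 mi mj => /addnI.
  rewrite -nneseriesZl; last first.
    by move=> j _; apply: integral_ge0 => v /(adic_unit n0)/mg.2.
  apply: lee_nneseries => [j _ _|j _].
    apply: mule_ge0; first by rewrite lee_fin invr_ge0 mulr_ge0// ltW.
    by apply: integral_ge0 => v /(adic_unit n0)/mg.2.
  rewrite int_g muleA -EFinM; apply: lee_wpmul2r => //; rewrite lee_fin.
  have qj : (0 <= q ^+ j.-1)%R by rewrite exprn_ge0// ltW.
  have thj : (0 <= th ^+ j)%R by rewrite exprn_ge0// ltW.
  apply: (@le_trans _ _ (t^-1 * (q ^+ j.-1 * (th ^+ m.+1 * n.+1%:R * th ^+ j)))%R).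
    have -> : ((t * psi t)^-1 * (psi t * q ^+ j.-1 * (th ^+ (m + j)%N - th ^+ (m + j)%N.+1)) =
        t^-1 * (q ^+ j.-1 * (th ^+ (m + j)%N - th ^+ (m + j)%N.+1)))%R.
      by field; rewrite !gt_eqF.
    rewrite ler_wpM2l ?invr_ge0 ?(ltW t0)// ler_wpM2l//.
    have -> : (th ^+ m.+1 * n.+1%:R * th ^+ j = th ^+ (m + j)%N)%R.
      transitivity (n.+1%:R * th * (th ^+ m * th ^+ j))%R; first by rewrite exprS; ring.
      by rewrite thn mul1r exprD.
    by rewrite gerBl exprn_ge0// ltW.
  rewrite ler_pdivrMl// /a.
  have -> : (t * (q ^+ j.-1 * n.+1%:R * th ^+ j) =
      q ^+ j.-1 * (t * n.+1%:R * th ^+ j))%R by ring.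
  by rewrite ler_wpM2l// ler_wpM2r// ler_wpM2r.
apply: (le_trans (ri_norm_nneseries X mu)).
apply: lime_le.
  apply: is_cvg_nneseries => j _ _; exact: ri_norm_ge0 (mu j).1.
apply: nearW => N; rewrite big_mkord.
have k0 : 0 <= ri_norm X k by exact: ri_norm_ge0 mk.1.
apply: (@le_trans _ _ (\sum_(j < N) (n.+1%:R * q ^+ j.-1)%:E * ri_norm X k)).
  apply: lee_sum => j _; rewrite /u ri_normZ//; last exact: (mS j).1.
  have -> : (n.+1%:R * q ^+ j.-1)%:E = (a j)%:E * (n.+1%:R ^+ j)%:E :> \bar R.
    have e : (th ^+ j * n.+1%:R ^+ j = 1)%R by rewrite -exprMn mulrC thn expr1n.
    by rewrite -EFinM; congr EFin; rewrite /a -[RHS]mulrA e mulr1 mulrC.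
  rewrite -muleA lee_wpmul2l ?lee_fin//.
  apply: (le_trans (ri_norm_adic_shiftn X n0 j c0)).
  rewrite lee_wpmul2l ?lee_fin ?exprn_ge0//.
  exact: ri_norm_adic_avg.
rewrite -ge0_sume_distrl; last by move=> j _; rewrite lee_fin mulr_ge0// exprn_ge0// ltW.
rewrite lee_wpmul2r// sumEFin lee_fin -mulr_sumr ler_wpM2l//.
exact: sum_pred_expr_le.
Qed.

(** * Powers and Jensen's inequality *)

(** Raising to the power p is an increasing bijection of [0, +oo], with inverse
    the power 1/p. *)
Lemma lt_poweR_inv (R : realType) (p t : R) (y : \bar R) :
  (0 < p)%R -> (0 <= t)%R -> 0 <= y -> (t%:E < y `^ p) = ((t `^ p^-1)%:E < y).
Proof.
move=> p0 t0 y0; rewrite !ltNge; congr (~~ _).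
have e : t%:E = (t `^ p^-1)%:E `^ p.
  by rewrite poweR_EFin -powRrM mulVf ?gt_eqF// powRr1.
apply/idP/idP => h; last first.
  rewrite e; apply: gt0_ler_poweR => //; first exact: ltW.
    by rewrite in_itv/= leey y0.
  by rewrite in_itv/= leey lee_fin powR_ge0.
have -> : y = (y `^ p) `^ p^-1 by rewrite -poweRrM mulfV ?gt_eqF// poweRe1.
rewrite -poweR_EFin; apply: gt0_ler_poweR => //.
- by rewrite invr_ge0 ltW.
- by rewrite in_itv/= leey poweR_ge0.
- by rewrite in_itv/= leey lee_fin t0.
Qed.

Lemma poweRD_le (R : realType) (p : R) (x y : \bar R) : (0 <= p)%R -> 0 <= x -> 0 <= y ->
  (x + y) `^ p <= (2 `^ p)%:E * (x `^ p + y `^ p).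
Proof.
move=> p0 x0 y0; wlog xy : x y x0 y0 / x <= y => [H|].
  by case/orP: (le_total x y) => /H; last rewrite addeC [X in _ * X]addeC; exact.
apply: (@le_trans _ _ ((2%:E * y) `^ p)).
  apply: gt0_ler_poweR => //; rewrite ?in_itv/= ?leey ?andbT.
  - by rewrite adde_ge0.
  - by rewrite mule_ge0.
  - by rewrite mule_natl mule2n leeD2r.
rewrite poweRM//; apply: lee_wpmul2l; first by rewrite lee_fin powR_ge0.
by rewrite leeDr// poweR_ge0.
Qed.

(** The graph of the concave function x^r lies below its tangent at b; this is
    Young's inequality for (x/b)^r and 1 with exponents 1/r and 1/(1-r). *)
Lemma powR_tangent (R : realType) (r x b : R) : (0 < r)%R -> (r <= 1)%R ->
  (0 <= x)%R -> (0 < b)%R ->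
  (x `^ r <= r * b `^ (r - 1) * x + (1 - r) * b `^ r)%R.
Proof.
move=> r0 r1 x0 b0.
have [->|rn1] := eqVneq r 1%R.
  by rewrite subrr powRr0 powRr1// mul0r addr0 !mul1r.
have r1' : (0 < 1 - r)%R by rewrite subr_gt0 lt_neqAle rn1.
have y0 : (0 <= x / b)%R by rewrite divr_ge0// ltW.
have := @conjugate_powR R ((x / b) `^ r)%R 1%R (r^-1)%R ((1 - r)^-1)%R (powR_ge0 _ _) ler01.
rewrite !invr_gt0 !invrK => /(_ r0 r1'); rewrite addrC subrK => /(_ erefl).
rewrite mulr1 -powRrM mulfV ?gt_eqF// powRr1// powR1 mul1r => H.
have br : (0 < b `^ r)%R by exact: powR_gt0.
have -> : (x `^ r = (x / b) `^ r * b `^ r)%R.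
  by rewrite -powRM// ?(ltW b0)// divfK// gt_eqF.
have -> : (r * b `^ (r - 1) * x + (1 - r) * b `^ r = (x / b * r + (1 - r)) * b `^ r)%R.
  rewrite powRB; last by apply/implyP => _; rewrite gt_eqF.
  by rewrite powRr1 ?(ltW b0)//; field; rewrite gt_eqF.
by rewrite ler_pM2r.
Qed.

Lemma poweR_tangent (R : realType) (r b : R) (x : \bar R) : (0 < r)%R -> (r <= 1)%R ->
  0 <= x -> (0 < b)%R ->
  x `^ r <= (r * b `^ (r - 1))%:E * x + ((1 - r) * b `^ r)%:E.
Proof.
move=> r0 r1 x0 b0; case: x x0 => [x| |//] x0.
  by rewrite poweR_EFin -EFinM -EFinD lee_fin powR_tangent.
by rewrite gt0_muley ?addye ?leey// lte_fin mulr_gt0// powR_gt0.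
Qed.

(** Jensen's inequality for the concave function x^r and the uniform probability
    on (0,t): integrate the tangent inequality at the mean B of g.  The tangent
    may be vertical when B = 0, but then g vanishes almost everywhere. *)
Lemma jensen_poweR (R : realType) (r t : R) (g : R -> \bar R) :
  (0 < r)%R -> (r <= 1)%R -> (0 < t)%R -> measurable_fun `]0%R, t[ g ->
  (forall x : R, `]0%R, t[%classic x -> 0 <= g x) ->
  ((t^-1)%:E * \int[leb]_(x in `]0%R, t[) (g x `^ r)) `^ r^-1 <=
  (t^-1)%:E * \int[leb]_(x in `]0%R, t[) g x.
Proof.
move=> r0 r1 t0 mg g0; set I := \int[leb]_(x in _) g x.
have mgr : measurable_fun `]0%R, t[ (fun x => g x `^ r).
  exact: (measurableT_comp (measurable_poweR r) mg).
have I0 : 0 <= I by exact: integral_ge0.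
have J0 : 0 <= \int[leb]_(x in `]0%R, t[) (g x `^ r).
  by apply: integral_ge0 => x _; exact: poweR_ge0.
have ti0 : (0 < t^-1)%R by rewrite invr_gt0.
have [Ioo|Ifin] := eqVneq I +oo.
  by rewrite Ioo gt0_muley ?leey// lte_fin.
have IE : I = (fine I)%:E by rewrite fineK// ge0_fin_numE// ltey.
pose B := (t^-1 * fine I)%R.
have BE : (t^-1)%:E * I = B%:E by rewrite IE.
(* B = 0: both sides vanish. *)
have [IE0|In0] := eqVneq I 0.
  have ae0 : ae_eq leb `]0%R, t[%classic g (cst 0).
    apply/(ae_eq_integral_abs leb (measurable_itv _) mg).
    rewrite -[RHS]IE0; apply: eq_integral => x; rewrite inE => Ix.
    by rewrite gee0_abs// g0.
  have -> : \int[leb]_(x in `]0%R, t[) (g x `^ r) = 0.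
    have ae1 : ae_eq leb `]0%R, t[%classic (fun x => g x `^ r) (cst 0).
      case: ae0 => N [mN N0 sub]; exists N; split => // x h; apply: sub => /= gx.
      by apply: h => /gx ->; rewrite poweR0r// gt_eqF.
    apply: etrans (integral0 leb `]0%R, t[%classic).
    apply: (@ae_eq_integral _ _ R leb `]0%R, t[%classic (cst 0) (fun x => g x `^ r)).
    - exact: measurable_itv.
    - exact: mgr.
    - exact: measurable_cst.
    - exact: ae1.
  by rewrite IE0 !mule0 poweR0r// gt_eqF// invr_gt0.
have B0 : (0 < B)%R.
  by rewrite mulr_gt0// fine_gt0// lt_neqAle eq_sym In0 I0 ltey.
suff H : (t^-1)%:E * \int[leb]_(x in `]0%R, t[) (g x `^ r) <= B%:E `^ r.
  rewrite BE -[X in _ <= X]poweRe1 ?lee_fin ?(ltW B0)// -(mulfV (lt0r_neq0 r0)) poweRrM.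
  apply: gt0_ler_poweR H; first by rewrite invr_ge0 ltW.
  - by rewrite in_itv/= leey mule_ge0// lee_fin ltW.
  - by rewrite in_itv/= leey lee_fin powR_ge0.
rewrite lee_pdivrMl//.
(* c1 and c2 are the coefficients of the tangent at B. *)
pose c1 := (r * B `^ (r - 1))%R; pose c2 := ((1 - r) * B `^ r)%R.
have c10 : (0 <= c1)%R by rewrite mulr_ge0 ?powR_ge0// ltW.
have c20 : (0 <= c2)%R by rewrite mulr_ge0 ?powR_ge0// subr_ge0.
apply: (@le_trans _ _ (\int[leb]_(x in `]0%R, t[) (c1%:E * g x + c2%:E))).
  apply: ge0_le_integral => //.
  - by move=> x _; exact: poweR_ge0.
  - apply: emeasurable_funD; last exact: measurable_cst.
    by apply: emeasurable_funM => //; exact: measurable_cst.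
  - by move=> x Ix; apply: poweR_tangent => //; exact: g0.
rewrite ge0_integralD//; first last.
- by apply: emeasurable_funM => //; exact: measurable_cst.
- by move=> x Ix; rewrite mule_ge0// g0.
rewrite ge0_integralZl// integral_cst//= lebesgue_length ?(ltW t0)// subr0 -/I IE.
rewrite -!EFinM -EFinD lee_fin /c1 /c2.
have -> : fine I = (t * B)%R by rewrite /B mulrA mulfV ?mul1r// gt_eqF.
rewrite powRB; last by apply/implyP => _; rewrite gt_eqF.
rewrite powRr1 ?(ltW B0)// le_eqVlt; apply/orP; left; apply/eqP; field.
by rewrite gt_eqF.
Qed.

(** * Oscillation and rearrangement *)

Lemma integral_inv_sqr (R : realType) (a : R) : (0 < a < 1)%R ->
  \int[leb]_(s in `]a, 1%R[) ((s ^- 2)%R)%:E = (a^-1 - 1)%:E.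
Proof.
move=> /andP[a0 a1].
have ct s : (0 < s)%R -> {for s, continuous (fun x : R => x^-1)%R}.
  by move=> s0; apply: inv_continuous; rewrite gt_eqF.
have ct2 s : (0 < s)%R -> {for s, continuous (fun x : R => x ^- 2)%R}.
  move=> s0; apply: (@continuous_comp _ _ _ (fun x : R => x ^+ 2)%R (fun x : R => x^-1)%R).
    exact: exprn_continuous.
  by apply: inv_continuous; rewrite gt_eqF// exprn_gt0.
have mi : measurable_fun `]a, 1%R[ (fun s : R => ((s ^- 2)%R)%:E).
  apply: antitone_measurable; first exact: interval_is_interval.
  move=> x y /=; rewrite !in_itv/= => /andP[ax _] /andP[ay _] xy.
  rewrite lee_fin lef_pV2 ?posrE ?exprn_gt0 ?(lt_trans a0)//.
  by rewrite ler_pXn2r// ?nnegrE ?ltW// (lt_trans a0).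
rewrite -(integral_itv_bndoo true false mi).
rewrite (@continuous_FTC2 R (fun s => s ^- 2)%R (fun s => - s^-1)%R a 1%R a1).
- by rewrite -EFinB invr1; congr EFin; ring.
- apply: continuous_in_subspaceT => s; rewrite inE/= in_itv/= => /andP[as_ _].
  exact/ct2/(lt_le_trans a0).
- split.
  + move=> s; rewrite in_itv/= => /andP[as_ _].
    apply: derivableN; apply: derivableV => //.
    by rewrite gt_eqF// (lt_trans a0).
  + by apply: cvg_at_right_filter; apply: cvgN; exact: ct.
  + by apply: cvg_at_left_filter; apply: cvgN; exact: ct.
- move=> s; rewrite in_itv/= => /andP[as_ _].
  have s0 : s != 0%R by rewrite gt_eqF// (lt_trans a0).
  rewrite derive1E deriveN; last exact: derivableV.
  by rewrite deriveV// derive_id scaleNr opprK [_ *: _]mulr1.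
Qed.

Section Oscillation.
Variables (R : realType) (g : R -> \bar R).
Hypothesis g0 : L0 g.
Let w := rearr g.

Lemma mplus_rearr : mplus w.
Proof.
split; last by move=> x _; exact: rearr_ge0.
exact: measurable_rearr (@unit_interval R).
Qed.

Lemma rearr_le_max_rearr (t : R) : (0 < t)%R -> w t <= max_rearr g t.
Proof.
move=> t0; have -> : w t = (t^-1)%:E * \int[leb]_(s in `]0%R, t[) cst (w t) s.
  rewrite integral_cst//= lebesgue_length ?ltW// subr0.
  by rewrite muleCA -EFinM mulVf ?gt_eqF// mule1.
apply: lee_wpmul2l; first by rewrite lee_fin invr_ge0 ltW.
apply: ge0_le_integral => //.
- by move=> s _; exact: rearr_ge0.
- apply: measurable_rearr; exact: interval_is_interval.
- by move=> s /=; rewrite in_itv/= => /andP[_ /ltW]; exact: rearr_antitone.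
Qed.

Lemma oscillation_ge0 (t : R) : (0 < t)%R -> 0 <= oscillation g t.
Proof.
move=> t0; rewrite /oscillation sube_ge0; first exact: rearr_le_max_rearr.
by rewrite ge0_fin_numE ?rearr_ge0// (rearr_fin g0 t0).
Qed.

Lemma oscillation_mplus : mplus (oscillation g).
Proof.
split; last by move=> t /unit_itvP/andP[t0 _]; exact: oscillation_ge0.
apply: emeasurable_funB; last exact: mplus_rearr.1.
apply: emeasurable_funM; last exact: measurable_primitive mplus_rearr.
exact: measurable_inv_unit.
Qed.

(** Write w for [rearr g] and W for [max_rearr g].  Then w <= W, and
    W(t) = int_t^1 O(g,s) ds/s + W(1): as O(g,s) + w(s) = W(s), by Tonelli's
    theorem
      int_t^1 O(g,s) ds/s + int_t^1 w(s) ds/s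
        = int_0^1 w(u) (1 / max(t,u) - 1) du,
    and adding W(1) = int_0^1 w removes the -1.  What remains is
    W(t) + int_t^1 w(u) du/u, whose second term is finite and cancels. *)
Lemma integral_rearr_le_osc (t : R) : unit_itv t ->
  w t <= \int[leb]_(s in `]t, 1%R[) (oscillation g s * (s^-1)%:E) +
         \int[leb]_(s in unit_itv) `|g s|.
Proof.
move=> Ut; have /unit_itvP/andP[t0 t1] := Ut.
have sub := tail_subset_unit (ltW t0).
have mwt : measurable_fun `]t, 1%R[ w by apply: measurable_rearr; exact: interval_is_interval.
have mV (k : nat) (D : set R) : is_interval D -> D `<=` unit_itv ->
    measurable_fun D (fun s : R => ((s ^- k)%R)%:E).
  move=> iD sD; apply: antitone_measurable => // x y.
  move=> /sD/unit_itvP/andP[x0 _] /sD/unit_itvP/andP[y0 _] xy.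
  by rewrite lee_fin lef_pV2 ?posrE ?exprn_gt0// lerXn2r// nnegrE ltW.
have mV1 : measurable_fun `]t, 1%R[ (fun s : R => (s^-1)%:E).
  exact: (mV 1%N _ (@interval_is_interval _ _) sub).
have V0 (s : R) : `]t, 1%R[%classic s -> 0 <= (s^-1)%:E.
  by move=> /sub/unit_itvP/andP[s0 _]; rewrite lee_fin invr_ge0 ltW.
pose A := \int[leb]_(s in `]t, 1%R[) (oscillation g s * (s^-1)%:E).
pose B := \int[leb]_(s in `]t, 1%R[) (w s * (s^-1)%:E).
pose K := \int[leb]_(s in unit_itv) w s.
have <- : K = \int[leb]_(s in unit_itv) `|g s|.
  rewrite -(@equimeasurable_integral R w g) //; last 3 first.
  - exact: mplus_rearr.1.
  - exact: g0.1.
  - by move=> y /ltW y0; rewrite distribution_rearr//; exact: g0.1.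
  by apply: eq_integral => s _; rewrite gee0_abs// rearr_ge0.
rewrite -/A.
have AB : A + B = \int[leb]_(s in `]t, 1%R[) (max_rearr g s * (s^-1)%:E).
  rewrite -ge0_integralD//.
  - apply: eq_integral => s; rewrite inE => /[dup] /sub/unit_itvP/andP[s0 _] ts.
    rewrite -ge0_muleDl ?oscillation_ge0 ?rearr_ge0//; congr (_ * _).
    by rewrite /oscillation subeK// ge0_fin_numE ?rearr_ge0// (rearr_fin g0 s0).
  - by move=> s ts; rewrite mule_ge0 ?V0//; apply: oscillation_mplus.2; exact: sub.
  - apply: emeasurable_funM => //.
    exact: (measurable_funS (@measurable_unit R) sub oscillation_mplus.1).
  - by move=> s ts; rewrite mule_ge0 ?V0//; exact: rearr_ge0.
  - exact: emeasurable_funM.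
have B0 : 0 <= B by apply: integral_ge0 => s ts; rewrite mule_ge0 ?V0//; exact: rearr_ge0.
have Bfin : B \is a fin_num.
  rewrite ge0_fin_numE//.
  have wtfin := rearr_fin g0 t0.
  apply: (@le_lt_trans _ _ (\int[leb]_(s in `]t, 1%R[) cst (w t * (t^-1)%:E) s)).
    apply: ge0_le_integral => //.
    - by move=> s ts; rewrite mule_ge0 ?V0//; exact: rearr_ge0.
    - exact: emeasurable_funM.
    - move=> s /= ; rewrite in_itv/= => /andP[ts s1]; apply: lee_pmul.
      + exact: rearr_ge0.
      + by rewrite lee_fin invr_ge0 ltW// (lt_trans t0).
      + by apply: rearr_antitone; exact: ltW.
      + by rewrite lee_fin lef_pV2 ?posrE ?(ltW ts) ?(lt_trans t0 ts).
  rewrite integral_cst//= lebesgue_length ?(ltW t1)//.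
  have wf : w t \is a fin_num by rewrite ge0_fin_numE// rearr_ge0.
  by rewrite -[X in X < _]fineK ?ltry// !fin_numM.
rewrite -(leeD2rE _ _ Bfin) addeAC AB.
have mE : measurable_fun [set: R * R] (fun p => (p.2 < p.1)%R).
  by apply: measurable_fun_ltr; [exact: measurable_snd|exact: measurable_fst].
have mx0 u : unit_itv u -> (0 < Num.max t u < 1)%R.
  by move=> /unit_itvP/andP[u0 u1]; rewrite lt_max gt_max t0 t1 u1.
have -> : \int[leb]_(s in `]t, 1%R[) (max_rearr g s * (s^-1)%:E) =
    \int[leb]_(u in unit_itv) (w u * ((Num.max t u)^-1 - 1)%:E).
  transitivity (\int[leb]_(s in `]t, 1%R[)
      (((s ^- 2)%R)%:E * \int[leb]_(u in unit_itv `&` [set u | (u < s)%R]) w u)).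
    apply: eq_integral => s; rewrite inE => ts; have /unit_itvP/andP[s0 s1] := sub _ ts.
    rewrite (_ : _ `&` _ = `]0%R, s[%classic); last first.
      apply/seteqP; split=> u.
        by move=> [/unit_itvP/andP[u0 _] /= us]; rewrite in_itv/= u0.
      rewrite /= in_itv/= => /andP[u0 us]; split => //; apply/unit_itvP.
      by rewrite u0 (lt_trans us).
    by rewrite /max_rearr muleC muleA -EFinM -invfM -expr2.
  rewrite (@tonelli_rel R _ _ (fun s => ((s ^- 2)%R)%:E) w (fun s u => (u < s)%R)
     (measurable_itv _) (@measurable_unit R) mE (mV 2%N _ (@interval_is_interval _ _) sub)
     mplus_rearr.1 _ mplus_rearr.2); last first.
    by move=> s _; rewrite lee_fin invr_ge0 exprn_even_ge0.
  apply: eq_integral => u; rewrite inE => Uu; congr (_ * _).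
  rewrite -integral_inv_sqr; last exact: mx0.
  by congr (integral _ _ _); apply/seteqP; split=> s /=;
    rewrite !in_itv/= gt_max; [case=> /andP[-> ->] ->|case/andP=> /andP[-> ->] ->].
have mmax : measurable_fun unit_itv (fun u : R => ((Num.max t u)^-1)%:E).
  apply: antitone_measurable; first exact: unit_interval.
  move=> x y /mx0/andP[hx _] /mx0/andP[hy _] xy.
  by rewrite lee_fin lef_pV2 ?posrE// ge_max !le_max lexx xy orbT.
have max0 u : unit_itv u -> 0 <= ((Num.max t u)^-1)%:E.
  by move=> /mx0/andP[h _]; rewrite lee_fin invr_ge0 ltW.
have max1 u : unit_itv u -> 0 <= ((Num.max t u)^-1 - 1)%:E.
  by move=> /mx0/andP[h1 h2]; rewrite lee_fin subr_ge0 invf_ge1// ltW.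
have mmax1 : measurable_fun unit_itv (fun u : R => ((Num.max t u)^-1 - 1)%:E).
  rewrite (_ : (fun u => _) = (fun u => ((Num.max t u)^-1)%:E - 1)).
    by apply: emeasurable_funB => //; exact: measurable_cst.
  by apply/funext => u; rewrite EFinB.
rewrite -ge0_integralD//; first last.
- exact: mplus_rearr.1.
- by move=> u _; exact: rearr_ge0.
- by apply: emeasurable_funM => //; exact: mplus_rearr.1.
- by move=> u Uu; rewrite mule_ge0 ?max1//; exact: rearr_ge0.
have -> : \int[leb]_(u in unit_itv) (w u * ((Num.max t u)^-1 - 1)%:E + w u) =
    \int[leb]_(u in unit_itv) (w u * ((Num.max t u)^-1)%:E).
  apply: eq_integral => u; rewrite inE => Uu.
  rewrite -[X in _ + X]mule1 -ge0_muleDr ?max1// -EFinD subrK//.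
have Usplit : @unit_itv R = `]0%R, t[%classic `|` `[t, 1%R[%classic.
  by rewrite -itv_bndbnd_setU ?bnd_simp ?(ltW t1).
have mwm : measurable_fun unit_itv (fun u => w u * ((Num.max t u)^-1)%:E).
  by apply: emeasurable_funM => //; exact: mplus_rearr.1.
rewrite [in X in _ <= X]Usplit ge0_integral_setU//; first last.
- apply/disj_setPS => x [/=]; rewrite !in_itv/= => /andP[_ xt] /andP[tx _].
  by rewrite ltNge tx in xt.
- by move=> u; rewrite -Usplit => Uu; rewrite mule_ge0 ?max0//; exact: rearr_ge0.
- by rewrite -Usplit.
have sub2 := ico_subset_unit t0 (lexx 1%R).
apply: leeD.
  apply: (le_trans (rearr_le_max_rearr t0)); rewrite /max_rearr muleC.
  rewrite -(@ge0_integralZr _ _ _ leb _ (measurable_itv _) w).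
  - apply: ge0_le_integral => //.
    + by move=> u _; rewrite mule_ge0 ?lee_fin ?invr_ge0 ?(ltW t0)//; exact: rearr_ge0.
    + apply: emeasurable_funM; last exact: measurable_cst.
      by apply: measurable_rearr; exact: interval_is_interval.
    + exact: (measurable_funS (@measurable_unit R) (oo_subset_unit (ltW t1)) mwm).
    + move=> u /=; rewrite in_itv/= => /andP[_ /ltW ut].
      by rewrite (max_idPl ut).
  - by apply: measurable_rearr; exact: interval_is_interval.
  - by move=> u _; exact: rearr_ge0.
  - by rewrite lee_fin invr_ge0 ltW.
apply: (@le_trans _ _ (\int[leb]_(u in `]t, 1%R[) (w u * ((Num.max t u)^-1)%:E))).
  rewrite le_eqVlt; apply/orP; left; apply/eqP; apply: eq_integral => u.
  by rewrite inE/= in_itv/= => /andP[/ltW tu _]; rewrite (max_idPr tu).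
apply: (@ge0_subset_integral _ _ _ leb _ _ (measurable_itv _) (measurable_itv _)
  (fun u => w u * ((Num.max t u)^-1)%:E)).
- exact: (measurable_funS (@measurable_unit R) sub2 mwm).
- by move=> u /sub2 Uu; rewrite mule_ge0 ?max0//; exact: rearr_ge0.
- by move=> u /=; rewrite !in_itv/= => /andP[/ltW -> ->].
Qed.

End Oscillation.

(** * Tail integrals *)

Lemma tail_mplus (R : realType) (g : R -> \bar R) : mplus g ->
  mplus (fun t => \int[leb]_(u in `]t, 1%R[) g u).
Proof.
move=> [mg g0].
have sub (t : R) : unit_itv t -> `]t, 1%R[ `<=` @unit_itv R.
  by move=> /unit_itvP/andP[/ltW t0 _]; exact: tail_subset_unit.
split; last by move=> t Ut; apply: integral_ge0 => u /(sub _ Ut)/g0.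
apply: antitone_measurable; first exact: unit_interval.
move=> x y Ux Uy xy.
apply: (@ge0_subset_integral _ _ _ leb _ _ (measurable_itv _) (measurable_itv _) g
  (measurable_funS (@measurable_unit R) (sub _ Ux) mg)) => [u /(sub _ Ux)/g0//|].
by move=> u /=; rewrite !in_itv/= => /andP[/(le_lt_trans xy) -> ->].
Qed.

(** Above the height G(s), the level set of an antitone G stays to the left
    of s. *)
Lemma rearr_le_antitone (R : realType) (G : R -> \bar R) (s : R) : mplus G ->
  (forall x y, unit_itv x -> unit_itv y -> (x <= y)%R -> G y <= G x) ->
  unit_itv s -> rearr G s <= G s.
Proof.
move=> [mG G0] aG Us; rewrite leNgt; apply/negP => h.
have Gfin : G s \is a fin_num by rewrite ge0_fin_numE ?G0// (lt_le_trans h)// leey.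
rewrite -(fineK Gfin) lt_rearr ?fine_ge0 ?G0// in h.
move: h; rewrite ltNge => /negP; apply.
have /unit_itvP/andP[s0 s1] := Us.
have -> : s%:E = leb `]0%R, s[ by rewrite lebesgue_length ?(ltW s0)// subr0.
apply: le_measure; rewrite ?inE//; first exact: measurable_level.
move=> x [Ux] /=; rewrite gee0_abs ?G0// fineK// => h.
have /unit_itvP/andP[x0 _] := Ux; rewrite in_itv/= x0 /= ltNge; apply/negP => sx.
by have := lt_le_trans h (aG _ _ Us Ux sx); rewrite ltxx.
Qed.

(** Right continuity gives room: a value below G(t) is exceeded on an interval
    (0, t') with t' > t. *)
Lemma rearr_ge_antitone (R : realType) (G : R -> \bar R) (t : R) : mplus G ->
  (forall x y, unit_itv x -> unit_itv y -> (x <= y)%R -> G y <= G x) ->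
  (forall y : R, y%:E < G t -> exists2 t' : R, (t < t' < 1)%R & y%:E < G t') ->
  unit_itv t -> G t <= rearr G t.
Proof.
move=> [mG G0] aG rcG Ut; rewrite leNgt; apply/negP => h.
have wfin : rearr G t \is a fin_num.
  by rewrite ge0_fin_numE ?rearr_ge0// (lt_le_trans h)// leey.
have := h; rewrite -(fineK wfin) => /rcG[t' /andP[tt' t'1] yt'].
have /unit_itvP/andP[t0 t1] := Ut.
have Ut' : unit_itv t' by apply/unit_itvP; rewrite (lt_trans t0).
suff : (fine (rearr G t))%:E < rearr G t by rewrite fineK// ltxx.
rewrite lt_rearr ?fine_ge0 ?rearr_ge0//.
apply: (@lt_le_trans _ _ t'%:E); first by rewrite lte_fin.
have -> : t'%:E = leb `]0%R, t'[ by rewrite lebesgue_length ?subr0// ltW// (lt_trans t0).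
apply: le_measure; rewrite ?inE//; first exact: measurable_level.
move=> x xt'; have Ux := oo_subset_unit (ltW t'1) xt'; split => //=.
move: xt'; rewrite /= in_itv/= => /andP[_ /ltW xt'].
by rewrite gee0_abs ?G0//; apply: lt_le_trans yt' _; exact: aG.
Qed.

Section Tail.
Variables (R : realType) (phi : R -> \bar R).
Hypothesis mphi : mplus phi.
Let G t := \int[leb]_(u in `]t, 1%R[) phi u.

Lemma tail_antitone (x y : R) : unit_itv x -> unit_itv y -> (x <= y)%R -> G y <= G x.
Proof.
move=> /unit_itvP/andP[x0 _] _ xy.
apply: (@ge0_subset_integral _ _ _ leb _ _ (measurable_itv _) (measurable_itv _) phi).
- exact: (measurable_funS (@measurable_unit R) (tail_subset_unit (ltW x0)) mphi.1).
- by move=> u /(tail_subset_unit (ltW x0)); exact: mphi.2.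
- by move=> u /=; rewrite !in_itv/= => /andP[/(le_lt_trans xy) -> ->].
Qed.

Lemma tail_right_continuous (t y : R) : unit_itv t -> y%:E < G t ->
  exists2 t' : R, (t < t' < 1)%R & y%:E < G t'.
Proof.
move=> /unit_itvP/andP[t0 t1] yG; apply: contrapT => H.
have {}H (t' : R) : (t < t' < 1)%R -> G t' <= y%:E.
  by move=> tt'; rewrite leNgt; apply/negP => h; apply: H; exists t'.
(* n.+2 rather than n.+1, to keep these points below 1. *)
pose e n : R := (t + (1 - t) / n.+2%:R)%R.
have e0 n : (t < e n < 1)%R.
  rewrite ltrDl divr_gt0 ?subr_gt0//= -ltrBrDl ltr_pdivrMr// ltr_pMr ?subr_gt0//.
  by rewrite ltr1n.
pose F n := `](e n), 1%R[%classic.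
have FU : \bigcup_n F n = `]t, 1%R[%classic.
  apply/seteqP; split=> u.
    move=> [n _]; rewrite /F /= !in_itv/= => /andP[eu ->].
    by have /andP[te _] := e0 n; rewrite (lt_trans te).
  rewrite /= in_itv/= => /andP[tu u1].
  have : (0 < (u - t) / (1 - t))%R by rewrite divr_gt0// subr_gt0.
  move=> /ltr_add_invr[n]; rewrite add0r ltr_pdivlMr ?subr_gt0// => hn.
  exists n => //; rewrite /F /= in_itv/= u1 andbT /e -ltrBrDl (le_lt_trans _ hn)//.
  by rewrite mulrC ler_pM2r ?subr_gt0// lef_pV2 ?posrE// ler_nat.
have ndF : nondecreasing_seq F.
  move=> m n mn; apply/subsetPset => u; rewrite /F /= !in_itv/= => /andP[eu ->].
  rewrite andbT; apply: le_lt_trans eu.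
  by rewrite lerD2l ler_pM2l ?subr_gt0// lef_pV2 ?posrE// ler_nat !ltnS.
have subF n : F n `<=` @unit_itv R.
  by apply: tail_subset_unit; have /andP[te _] := e0 n; rewrite ltW// (lt_trans t0).
have mF n : measurable (F n) by exact: measurable_itv.
have cv : \int[leb]_(u in F n) phi u @[n --> \oo] --> \int[leb]_(u in \bigcup_n F n) phi u.
  apply: ge0_nondecreasing_set_cvg_integral => //.
  - by move=> n; exact: (measurable_funS (@measurable_unit R) (subF n) mphi.1).
  - by move=> n u /subF; exact: mphi.2.
rewrite FU in cv.
have : G t <= y%:E.
  rewrite /G -(cvg_lim _ cv)//; apply: lime_le; first by apply/cvg_ex; eexists; exact: cv.
  by apply: nearW => n; exact: (H _ (e0 n)).
by rewrite leNgt yG.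
Qed.

Lemma rearr_tail (t : R) : unit_itv t -> rearr G t = G t.
Proof.
move=> Ut; have mG := tail_mplus mphi; apply/le_anti/andP; split.
  by apply: rearr_le_antitone => //; exact: tail_antitone.
apply: rearr_ge_antitone => //; first exact: tail_antitone.
by move=> y; exact: tail_right_continuous.
Qed.

(** Exchanging the integrals, each u contributes phi(u) times the length of
    (0, min(u,t)). *)
Lemma integral_tail (t : R) : (0 < t)%R -> (t <= 1)%R ->
  \int[leb]_(s in `]0%R, t[) G s =
  \int[leb]_(u in `]0%R, t[) (u%:E * phi u) + t%:E * G t.
Proof.
move=> t0 t1.
have mu : measurable_fun unit_itv (fun u : R => (Num.min u t)%:E).
  apply: monotone_measurable; first exact: unit_interval.
  by move=> x y _ _ xy; rewrite lee_fin le_min !ge_min xy lexx orbT.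
have min0 u : unit_itv u -> (0 <= Num.min u t)%R.
  by move=> /unit_itvP/andP[u0 _]; rewrite le_min !ltW.
have mm : measurable_fun unit_itv (fun u => phi u * (Num.min u t)%:E).
  by apply: emeasurable_funM => //; exact: mphi.1.
have mm0 u : unit_itv u -> 0 <= phi u * (Num.min u t)%:E.
  by move=> Uu; rewrite mule_ge0 ?lee_fin ?min0// mphi.2.
have subt := oo_subset_unit t1.
transitivity (\int[leb]_(u in unit_itv) (phi u * (Num.min u t)%:E)).
  transitivity (\int[leb]_(s in `]0%R, t[)
    (cst 1 s * \int[leb]_(u in unit_itv `&` [set u | (s < u)%R]) phi u)).
    apply: eq_integral => s; rewrite inE/= in_itv/= => /andP[s0 st].
    rewrite mul1e /G; congr (integral _ _ _); apply/seteqP; split=> u.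
      rewrite /= in_itv/= => /andP[su u1]; split => //; apply/unit_itvP.
      by rewrite u1 (lt_trans s0).
    by move=> [/unit_itvP/andP[_ u1] /= su]; rewrite in_itv/= su.
  rewrite (@tonelli_rel R _ _ (cst 1) phi (fun s u => (s < u)%R) (measurable_itv _)
    (@measurable_unit R) (@measurable_lt_rel R) (measurable_cst _) mphi.1
    (fun _ _ => lee01) mphi.2).
  apply: eq_integral => u; rewrite inE => Uu; congr (_ * _).
  rewrite (_ : _ `&` _ = `]0%R, (Num.min u t)[%classic).
    by rewrite integral_cst//= lebesgue_length ?min0// subr0 mul1e.
  apply/seteqP; split=> s /=; rewrite !in_itv/= lt_min.
    by case=> /andP[-> ->] ->.
  by case/and3P => -> -> ->.
have [t1'|] := ltP t 1%R; last first.
  move=> t1'; have {}t1' : t = 1%R by apply/le_anti; rewrite t1 t1'.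
  have e0 : `]1%R, 1%R[%classic = set0 :> set R by rewrite set_itv_ge// bnd_simp ltxx.
  rewrite t1' /G e0 integral_set0 mule0 adde0.
  apply: eq_integral => u; rewrite inE => /unit_itvP/andP[_ /ltW u1].
  by rewrite (min_idPl u1) muleC.
have Usplit : @unit_itv R = `]0%R, t[%classic `|` `[t, 1%R[%classic.
  by rewrite -itv_bndbnd_setU ?bnd_simp ?(ltW t1').
have sub2 := ico_subset_unit t0 (lexx 1%R).
rewrite Usplit ge0_integral_setU//; first last.
- apply/disj_setPS => x [/=]; rewrite !in_itv/= => /andP[_ xt] /andP[tx _].
  by rewrite ltNge tx in xt.
- by move=> u; rewrite -Usplit; exact: mm0.
- by rewrite -Usplit.
congr (_ + _).
  apply: eq_integral => u; rewrite inE/= in_itv/= => /andP[_ /ltW ut].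
  by rewrite (min_idPl ut) muleC.
have mphit : measurable_fun `]t, 1%R[ phi.
  exact: (measurable_funS (@measurable_unit R) (tail_subset_unit (ltW t0)) mphi.1).
rewrite /G (integral_itv_obnd_cbnd mphit) -ge0_integralZl//.
- apply: eq_integral => u; rewrite inE/= in_itv/= => /andP[tu _].
  by rewrite (min_idPr tu) muleC.
- exact: (measurable_funS (@measurable_unit R) sub2 mphi.1).
- by move=> u /sub2; exact: mphi.2.
- by rewrite lee_fin ltW.
Qed.

(** A tail integral G is its own rearrangement, so [integral_tail] computes
    its oscillation: the term t G(t) is exactly what the subtraction removes. *)
Lemma oscillation_tail_le (t : R) : unit_itv t -> G t < +oo ->
  oscillation G t <= (t^-1)%:E * \int[leb]_(u in `]0%R, t[) (u%:E * phi u).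
Proof.
move=> Ut Gt; have /unit_itvP/andP[t0 t1] := Ut.
have mG := tail_mplus mphi.
have Gfin : G t \is a fin_num by rewrite ge0_fin_numE// mG.2.
rewrite /oscillation rearr_tail// leeBlDr//.
rewrite /max_rearr.
have -> : \int[leb]_(s in `]0%R, t[) rearr G s = \int[leb]_(s in `]0%R, t[) G s.
  by apply: eq_integral => s; rewrite inE => /(oo_subset_unit (ltW t1)); exact: rearr_tail.
rewrite integral_tail ?(ltW t1)// ge0_muleDr; first last.
- by rewrite mule_ge0 ?lee_fin ?(ltW t0)// mG.2.
- apply: integral_ge0 => u /[dup] /(oo_subset_unit (ltW t1)) Uu.
  rewrite /= in_itv/= => /andP[u0 _].
  by rewrite mule_ge0 ?lee_fin ?(ltW u0)// mphi.2.
by rewrite muleA -EFinM mulVf ?mul1e// gt_eqF.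
Qed.

End Tail.

(** * The three inequalities *)

Lemma abs_pow_mplus (R : realType) (f : R -> \bar R) (p : R) :
  measurable_fun unit_itv f -> mplus (abs_pow f p).
Proof.
move=> mf; split; last by move=> x _; exact: poweR_ge0.
apply: (measurableT_comp (measurable_poweR p)); exact: measurableT_comp.
Qed.

Lemma abs_powK (R : realType) (f : R -> \bar R) (p : R) (x : R) : p != 0%R ->
  abs_pow (abs_pow f p) p^-1 x = `|f x|.
Proof.
by move=> p0; rewrite /abs_pow gee0_abs ?poweR_ge0// -poweRrM mulfV// poweRe1.
Qed.

Lemma abs_pow_L0 (R : realType) (f : R -> \bar R) (p : R) : L0 f -> L0 (abs_pow f p).
Proof.
move=> [mf fin]; split; first exact: (abs_pow_mplus p mf).1.
case: fin => N [mN N0 sub]; exists N; split => // x h; apply: sub => /= fx.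
by apply: h => Ux; apply: fin_num_poweR; rewrite abse_fin_num; exact: fx.
Qed.

Lemma Qop_mplus (R : realType) (psi : R -> R) (r : R) (f : R -> \bar R) :
  class_A0 psi -> measurable_fun unit_itv f -> mplus (Qop psi r f).
Proof.
move=> hpsi mf; split; last by move=> x _; exact: poweR_ge0.
apply: (measurableT_comp (measurable_poweR _)).
apply: (tail_mplus (g := fun s => ((psi s)%:E * `|f s|) `^ r * (s^-1)%:E) _).1.
split; last first.
  move=> s /unit_itvP/andP[s0 _]; rewrite mule_ge0 ?poweR_ge0//.
  by rewrite lee_fin invr_ge0 ltW.
apply: emeasurable_funM.
  apply: (measurableT_comp (measurable_poweR r)).
  apply: emeasurable_funM; first exact: measurable_A0.
  exact: measurableT_comp.
exact: measurable_inv_unit.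
Qed.

Lemma osc_quotient_mplus (R : realType) (psi : R -> R) (p : R) (g : R -> \bar R) :
  class_A0 psi -> L0 g ->
  mplus (fun t => oscillation g t `^ p * ((psi t)^-1)%:E).
Proof.
move=> hpsi g0; split; last first.
  by move=> t Ut; rewrite mule_ge0 ?poweR_ge0// lee_fin invr_ge0 ltW// (A0_pos hpsi).
apply: emeasurable_funM.
  exact: (measurableT_comp (measurable_poweR p) (oscillation_mplus g0).1).
apply: antitone_measurable; first exact: unit_interval.
move=> x y Ux Uy xy; rewrite lee_fin lef_pV2 ?posrE ?(A0_pos hpsi)//.
exact: (A0_incr hpsi).
Qed.

Lemma ri_norm_cst (R : realType) (X : ri_space R) : ri_norm X (cst 1) < +oo.
Proof.
apply: le_lt_trans (bfn_indic (ri_bfn X) (@measurable_unit R) (@subset_refl _ _)).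
apply: (bfn_mono (ri_bfn X)).
- split => [|x _]; last by rewrite lee_fin.
  by apply/measurable_EFinP; exact: measurable_indic.
- by apply: mplus_abs; exact: measurable_cst.
- by apply: aeW => x Ux; rewrite indicE mem_set//= normr1.
Qed.

(** The level sets of |f| at height t are those of |f|^r at height t^r, so the
    rearrangement of |f|^r, raised to the power 1/r, is equimeasurable with f. *)
Lemma ri_norm_rearr_pow (R : realType) (X : ri_space R) (r : R) (f : R -> \bar R) :
  (0 < r)%R -> measurable_fun unit_itv f ->
  ri_norm X f = ri_norm X (fun t => rearr (abs_pow f r) t `^ r^-1).
Proof.
move=> r0 mf; have [mg _] := abs_pow_mplus r mf.
have mw : measurable_fun unit_itv (rearr (abs_pow f r)).
  exact: measurable_rearr (@unit_interval R).
apply: equimeasurable_ri_norm => //.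
  exact: (measurableT_comp (measurable_poweR _) mw).
move=> t t0; transitivity (distribution_fun (abs_pow f r) (t `^ r)%R).
  rewrite /distribution_fun; congr (lebesgue_measure _); apply/seteqP.
  have e x : (t%:E < `|f x|) = ((t `^ r)%:E < `|abs_pow f r x|).
    rewrite -(abs_powK f x (lt0r_neq0 r0)) /abs_pow.
    by rewrite lt_poweR_inv ?invr_gt0 ?invrK ?(ltW t0)// abse_ge0.
  by split=> x [Ux h]; split => //; move: h; rewrite /= e.
rewrite -distribution_rearr ?powR_ge0//.
rewrite /distribution_fun; congr (lebesgue_measure _); apply/seteqP.
have e x : (t%:E < `|rearr (abs_pow f r) x `^ r^-1|) =
    ((t `^ r)%:E < `|rearr (abs_pow f r) x|).
  rewrite !gee0_abs ?poweR_ge0 ?rearr_ge0//.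
  by rewrite lt_poweR_inv ?invr_gt0 ?invrK ?(ltW t0)// rearr_ge0.
by split=> x [Ux h]; split => //; move: h; rewrite /= e.
Qed.

Section Equivalence.
Variables (R : realType) (r : R).
Hypotheses (r0 : (0 < r)%R) (r1 : (r <= 1)%R).
Variables (X Y : ri_space R) (psi : R -> R).
Hypothesis hpsi : class_A0 psi.

Let rn0 : r != 0%R. Proof. by rewrite gt_eqF. Qed.
Let ri0 : (0 < r^-1)%R. Proof. by rewrite invr_gt0. Qed.
Let rin0 : (r^-1 != 0)%R. Proof. by rewrite gt_eqF. Qed.

(** The factor 1/psi in the function is the one that the operator cancels. *)
Lemma Qop_osc (g : R -> \bar R) (t : R) : L0 g -> unit_itv t ->
  Qop psi r (fun t => oscillation g t `^ r^-1 * ((psi t)^-1)%:E) t =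
  (\int[leb]_(s in `]t, 1%R[) (oscillation g s * (s^-1)%:E)) `^ r^-1.
Proof.
move=> g0 /unit_itvP/andP[t0 t1]; congr (_ `^ _); apply: eq_integral => s.
rewrite inE/= in_itv/= => /andP[ts s1]; congr (_ * _).
have s0 := lt_trans t0 ts.
have Us : unit_itv s by apply/unit_itvP; rewrite s0.
have ps := A0_pos hpsi Us.
rewrite gee0_abs ?mule_ge0 ?poweR_ge0 ?lee_fin ?invr_ge0 ?(ltW ps)//.
rewrite muleCA -EFinM mulfV ?gt_eqF// mule1 -poweRrM mulVf// poweRe1//.
exact: oscillation_ge0.
Qed.

(** Apply the hypothesis to F = O(|f|^r)^(1/r) / psi.  By
    [integral_rearr_le_osc], the rearrangement of |f|^r is at most (Q F)^r plus
    the r-th power of the norm of f in L^r; take the power 1/r and use the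
    quasi-triangle inequality with constant 2^(1/r). *)
Lemma oscillation_bound_of_Qop_bound :
  (exists2 C : R, (0 < C)%R & forall f : R -> \bar R, ri_mem X f ->
     ri_norm Y (Qop psi r f) <= C%:E * ri_norm X f) ->
  exists2 C : R, (0 < C)%R & forall f : R -> \bar R, L0 f ->
     ri_norm Y f <= C%:E *
       (ri_norm X (fun t => oscillation (abs_pow f r) t `^ r^-1 * ((psi t)^-1)%:E)
        + Lr_norm r f).
Proof.
move=> [C C0 HC].
have K0 : 0 <= ri_norm Y (cst 1) by apply: ri_norm_ge0; exact: measurable_cst.
pose K := fine (ri_norm Y (cst 1)).
have KE : ri_norm Y (cst 1) = K%:E by rewrite fineK// ge0_fin_numE// ri_norm_cst.
have K0' : (0 <= K)%R by rewrite fine_ge0.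
pose c : R := (2 `^ r^-1)%R.
have c0 : (0 < c)%R by exact: powR_gt0.
exists (c * (C + K))%R; first by rewrite mulr_gt0// ltr_wpDr.
move=> f f0; pose g := abs_pow f r; have g0 : L0 g by exact: abs_pow_L0.
pose F t := oscillation g t `^ r^-1 * ((psi t)^-1)%:E.
have mF : mplus F by exact: osc_quotient_mplus.
rewrite -/F; have F0 := ri_norm_ge0 X mF.1.
have L0' : 0 <= Lr_norm r f by exact: poweR_ge0.
have cCK0 : (0 < c * (C + K))%R by rewrite mulr_gt0// ltr_wpDr.
have [Loo|Lfin] := eqVneq (Lr_norm r f) +oo.
  by rewrite Loo addey ?gt0_muley ?leey ?lte_fin// gt_eqF// (lt_le_trans _ F0)// ltNyr.
have [Foo|Ffin] := eqVneq (ri_norm X F) +oo.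
  by rewrite Foo addye ?gt0_muley ?leey ?lte_fin// gt_eqF// (lt_le_trans _ L0')// ltNyr.
have LE : Lr_norm r f = (fine (Lr_norm r f))%:E by rewrite fineK// ge0_fin_numE// ltey.
have /HC {}HC : ri_mem X F by split; [exact: mF.1|rewrite ltey].
have mQ := Qop_mplus r hpsi mF.1.
rewrite (ri_norm_rearr_pow Y r0 f0.1).
apply: (@le_trans _ _ (ri_norm Y (fun t =>
    c%:E * (Qop psi r F t + (fine (Lr_norm r f))%:E * 1)))).
  apply: ri_norm_le.
  - apply: (measurableT_comp (measurable_poweR _)).
    exact: measurable_rearr (@unit_interval R).
  - apply: emeasurable_funM; first exact: measurable_cst.
    by apply: emeasurable_funD; [exact: mQ.1|exact: measurable_cst].
  move=> t Ut; rewrite mule1 -LE !gee0_abs ?poweR_ge0//; last first.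
    by rewrite mule_ge0 ?lee_fin ?(ltW c0)// adde_ge0// mQ.2.
  rewrite (Qop_osc g0 Ut) /Lr_norm -/g.
  have Ut' := Ut; move/unit_itvP: Ut' => /andP[t0 t1].
  apply: le_trans (poweRD_le (ltW ri0) _ _); first last.
  - by apply: integral_ge0 => s _; exact: poweR_ge0.
  - apply: integral_ge0 => s /=; rewrite in_itv/= => /andP[ts s1].
    rewrite mule_ge0 ?lee_fin ?invr_ge0 ?(ltW (lt_trans t0 ts))//.
    exact/oscillation_ge0/(lt_trans t0 ts).
  have gE : \int[leb]_(s in unit_itv) `|g s| = \int[leb]_(s in unit_itv) g s.
    by apply: eq_integral => s _; rewrite gee0_abs// poweR_ge0.
  have := integral_rearr_le_osc g0 Ut; rewrite gE => H.
  apply: (gt0_ler_poweR (ltW ri0)) => //.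
  - by rewrite in_itv/= leey rearr_ge0.
  - by rewrite in_itv/= leey andbT (le_trans _ H)// rearr_ge0.
rewrite ri_normZ ?(ltW c0)//; last first.
  by apply: emeasurable_funD; [exact: mQ.1|exact: measurable_cst].
rewrite EFinM -muleA; apply: lee_wpmul2l; first by rewrite lee_fin ltW.
apply: le_trans (ri_normD _ _ _) _ => //.
  by split; [exact: measurable_cst|move=> x _; rewrite mule1 -LE].
rewrite (ri_normZ Y (f := cst 1)) ?fine_ge0// KE -LE.
rewrite ge0_muleDr//; apply: leeD.
  apply: (le_trans HC); apply: lee_wpmul2r => //.
  by rewrite lee_fin lerDl.
by rewrite muleC; apply: lee_wpmul2r => //; rewrite lee_fin lerDr ltW.
Qed.

(** Take h = |f|^r: then T h = (Q f)^r, and the convexified norms are the r-th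
    powers of the norms of Q f and f. *)
Lemma Qop_bound_of_Top_bound :
  (exists2 C : R, (0 < C)%R & forall h : R -> \bar R, cvx_mem X r^-1 h ->
     cvx_norm Y r^-1 (Top psi r h) <= C%:E * cvx_norm X r^-1 h) ->
  exists2 C : R, (0 < C)%R & forall f : R -> \bar R, ri_mem X f ->
     ri_norm Y (Qop psi r f) <= C%:E * ri_norm X f.
Proof.
move=> [C C0 HC]; exists (C `^ r^-1)%R; first exact: powR_gt0.
move=> f [mf fX]; pose h := abs_pow f r.
have mh := abs_pow_mplus r mf.
have hf : ri_norm X (abs_pow h r^-1) = ri_norm X f.
  apply: eq_ri_norm => //; first exact: (abs_pow_mplus _ mh.1).1.
  by move=> x _; rewrite abs_powK// abse_id.
have : cvx_mem X r^-1 h.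
  by split; [exact: mh.1|split; [exact: (abs_pow_mplus _ mh.1).1|rewrite hf]].
move=> /HC; rewrite /cvx_norm hf invrK => H.
have mQ := Qop_mplus r hpsi mf.
have TQ x : unit_itv x -> Top psi r h x = (\int[leb]_(s in `]x, 1%R[)
     (((psi s)%:E * `|f s|) `^ r * (s^-1)%:E)).
  move=> /unit_itvP/andP[x0 _]; apply: eq_integral => s.
  rewrite inE/= in_itv/= => /andP[xs s1].
  have Us : unit_itv s by apply/unit_itvP; rewrite (lt_trans x0 xs).
  by rewrite poweRM ?lee_fin ?(ltW (A0_pos hpsi Us)).
have I0 x : unit_itv x -> 0 <= \int[leb]_(s in `]x, 1%R[)
     (((psi s)%:E * `|f s|) `^ r * (s^-1)%:E).
  move=> /unit_itvP/andP[x0 _]; apply: integral_ge0 => s /=; rewrite in_itv/= => /andP[xs _].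
  by rewrite mule_ge0 ?poweR_ge0// lee_fin invr_ge0 ltW// (lt_trans x0).
have QY : ri_norm Y (Qop psi r f) = ri_norm Y (abs_pow (Top psi r h) r^-1).
  have e x : unit_itv x -> Qop psi r f x = abs_pow (Top psi r h) r^-1 x.
    by move=> Ux; rewrite /abs_pow TQ// gee0_abs// I0.
  apply: eq_ri_norm; [exact: mQ.1| |by move=> x /e ->].
  by apply: eq_measurable_fun mQ.1 => x; rewrite inE => /e.
rewrite QY.
set a := ri_norm Y _ in H *; set b := ri_norm X f in H *.
have a0 : 0 <= a by rewrite /a -QY; exact: ri_norm_ge0 mQ.1.
have b0 : 0 <= b by exact: ri_norm_ge0.
rewrite -[a]poweRe1// -[b]poweRe1// -(mulfV rn0) !poweRrM -poweR_EFin -poweRM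
  ?lee_fin ?(ltW C0) ?poweR_ge0//.
apply: gt0_ler_poweR => //; first exact: ltW.
- by rewrite in_itv/= leey poweR_ge0.
- by rewrite in_itv/= leey mule_ge0 ?poweR_ge0// lee_fin ltW.
Qed.

Lemma measurable_Top (h : R -> \bar R) : measurable_fun unit_itv h ->
  measurable_fun unit_itv (Top psi r h).
Proof.
move=> mh.
pose phi s := ((psi s `^ r)%R)%:E * h s * (s^-1)%:E.
have mphi : measurable_fun unit_itv phi.
  apply: emeasurable_funM.
    apply: emeasurable_funM => //.
    exact: (measurableT_comp (measurable_poweR r) (measurable_A0 hpsi)).
  exact: measurable_inv_unit.
(* The integral of a signed function is the difference of two tail integrals. *)
rewrite (_ : Top psi r h = fun t => \int[leb]_(s in `]t, 1%R[) phi^\+ s -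
    \int[leb]_(s in `]t, 1%R[) phi^\- s); last first.
  by apply/funext => t; rewrite /Top integralE.
apply: emeasurable_funB.
- apply: (tail_mplus (g := phi^\+) _).1; split; first exact: measurable_funepos.
  by move=> x _; exact: funepos_ge0.
- apply: (tail_mplus (g := phi^\-) _).1; split; first exact: measurable_funeneg.
  by move=> x _; exact: funeneg_ge0.
Qed.

(** Apply the hypothesis to f = (T|h|)^(1/r), and put k = |h|^(1/r).  By
    [oscillation_tail_le] the oscillation of f^r = T|h| is at most the mean of
    psi^r |h| = (psi k)^r over (0,t), so Jensen's inequality bounds O^(1/r) / psi
    by P_psi k, and [hardy_bounded] applies.  Likewise the norm of f in L^r is at
    most the integral of psi k, which is controlled by the norm of k in X. *)
Lemma Top_bound_of_oscillation_bound :
  (exists2 C : R, (0 < C)%R & forall f : R -> \bar R, L0 f ->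
     ri_norm Y f <= C%:E *
       (ri_norm X (fun t => oscillation (abs_pow f r) t `^ r^-1 * ((psi t)^-1)%:E)
        + Lr_norm r f)) ->
  exists2 C : R, (0 < C)%R & forall h : R -> \bar R, cvx_mem X r^-1 h ->
     cvx_norm Y r^-1 (Top psi r h) <= C%:E * cvx_norm X r^-1 h.
Proof.
move=> [C C0 HC].
have [M M0 psiM] := A0_bounded hpsi.
have [H H0 hardyX] := hardy_bounded X hpsi.
have [N N0 intX] := bfn_int (ri_bfn X) (@measurable_unit R) (@subset_refl _ _).
pose D := (C * (H + M * N))%R.
have D0 : (0 < D)%R by rewrite mulr_gt0// addr_gt0// mulr_gt0.
exists (D `^ r)%R; first exact: powR_gt0.
move=> h [mh [_ kX]]; pose k := abs_pow h r^-1.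
have mk : mplus k by exact: abs_pow_mplus.
have kh x : k x `^ r = `|h x|.
  by have := abs_powK h x rin0; rewrite invrK /abs_pow gee0_abs ?poweR_ge0.
have kXE : ri_fun X k = ri_norm X k.
  by rewrite /ri_norm; congr (ri_fun X _); apply/funext => x; rewrite gee0_abs// poweR_ge0.
pose phi s := ((psi s `^ r)%R)%:E * `|h s| * (s^-1)%:E.
have psir0 s : 0 <= ((psi s `^ r)%R)%:E by rewrite lee_fin powR_ge0.
have mpsir : measurable_fun unit_itv (fun s => ((psi s `^ r)%R)%:E).
  exact: (measurableT_comp (measurable_poweR r) (measurable_A0 hpsi)).
have mah : measurable_fun unit_itv (fun s => `|h s|) by exact: measurableT_comp.
have mphi : mplus phi.
  split; last first.
    move=> s /unit_itvP/andP[s0 _].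
    by rewrite mule_ge0 ?lee_fin ?invr_ge0 ?(ltW s0)// mule_ge0.
  apply: emeasurable_funM; first exact: emeasurable_funM.
  exact: measurable_inv_unit.
pose G t := \int[leb]_(s in `]t, 1%R[) phi s.
have mG : mplus G by exact: tail_mplus.
have mpk : mplus (fun u => (psi u)%:E * k u).
  split; first by apply: emeasurable_funM; [exact: measurable_A0|exact: mk.1].
  by move=> x Ux; rewrite mule_ge0 ?mk.2// lee_fin ltW// (A0_pos hpsi).
have jen t : (0 < t)%R -> (t <= 1)%R ->
    ((t^-1)%:E * \int[leb]_(u in `]0%R, t[) (u%:E * phi u)) `^ r^-1 <=
    (t^-1)%:E * \int[leb]_(u in `]0%R, t[) ((psi u)%:E * k u).
  move=> t0 t1; have sub := oo_subset_unit t1.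
  have -> : \int[leb]_(u in `]0%R, t[) (u%:E * phi u) =
      \int[leb]_(u in `]0%R, t[) (((psi u)%:E * k u) `^ r).
    apply: eq_integral => u; rewrite inE => /sub Uu; have /unit_itvP/andP[u0 _] := Uu.
    rewrite poweRM ?kh ?poweR_EFin ?lee_fin ?(ltW (A0_pos hpsi Uu)) ?mk.2//.
    by rewrite /phi muleCA -EFinM mulfV ?mule1// gt_eqF.
  apply: jensen_poweR => //; first exact: (measurable_funS (@measurable_unit R) sub mpk.1).
  by move=> x /sub; exact: mpk.2.
have intk : \int[leb]_(u in unit_itv) k u <= N%:E * ri_norm X k.
  by rewrite -kXE; exact: intX.
have intpk : \int[leb]_(u in unit_itv) ((psi u)%:E * k u) <= (M * N)%:E * ri_norm X k.
  apply: (@le_trans _ _ (M%:E * \int[leb]_(u in unit_itv) k u)).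
    rewrite -(@ge0_integralZl _ _ _ leb _ (@measurable_unit R) k mk.1)
      ?lee_fin ?(ltW M0)//; last exact: mk.2.
    apply: ge0_le_integral => //; [exact: mpk.2|exact: mpk.1| |].
      by apply: emeasurable_funM; [exact: measurable_cst|exact: mk.1].
    by move=> u Uu; apply: lee_wpmul2r; [exact: mk.2|rewrite lee_fin psiM].
  by rewrite EFinM -muleA; apply: lee_wpmul2l => //; rewrite lee_fin ltW.
have kXfin : ri_norm X k < +oo by exact: kX.
have jen1 : (\int[leb]_(u in unit_itv) (u%:E * phi u)) `^ r^-1 <= (M * N)%:E * ri_norm X k.
  by apply: le_trans _ intpk; have := jen 1%R ltr01 (lexx 1%R); rewrite invr1 !mul1e.
have intG : (\int[leb]_(u in unit_itv) G u) `^ r^-1 <= (M * N)%:E * ri_norm X k.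
  (* At t = 1 the tail G(1) is an integral over the empty set. *)
  have e0 : `]1%R, 1%R[%classic = set0 :> set R by rewrite set_itv_ge// bnd_simp ltxx.
  have := integral_tail mphi ltr01 (lexx 1%R); rewrite e0 integral_set0 mule0 adde0.
  by move=> e; rewrite /unit_itv /G e.
have Gfin t : unit_itv t -> G t < +oo.
  move=> /unit_itvP/andP[t0 t1].
  have mup : mplus (fun u => u%:E * phi u).
    split; last first.
      move=> u Uu; rewrite mule_ge0 ?mphi.2// lee_fin.
      by move/unit_itvP: Uu => /andP[/ltW].
    by apply: emeasurable_funM; [exact: EFin_measurable|exact: mphi.1].
  have sub := tail_subset_unit (ltW t0).
  have fin : \int[leb]_(u in unit_itv) (u%:E * phi u) < +oo.
    apply: (lty_poweRy rin0); apply: (le_lt_trans jen1).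
    have : ri_norm X k \is a fin_num by rewrite ge0_fin_numE// ri_norm_ge0//; exact: mk.1.
    by move=> kf; rewrite -[X in X < _]fineK ?ltry// fin_numM.
  have tu0 : 0 <= (t^-1)%:E :> \bar R by rewrite lee_fin invr_ge0 ltW.
  apply: (@le_lt_trans _ _ ((t^-1)%:E * \int[leb]_(u in unit_itv) (u%:E * phi u))); last first.
    have uf : \int[leb]_(u in unit_itv) (u%:E * phi u) \is a fin_num.
      by rewrite ge0_fin_numE//; apply: integral_ge0 => u; exact: mup.2.
    by rewrite -[X in X < _]fineK ?ltry// fin_numM.
  apply: (@le_trans _ _ ((t^-1)%:E * \int[leb]_(u in `]t, 1%R[) (u%:E * phi u))); last first.
    apply: lee_wpmul2l => //.
    apply: (@ge0_subset_integral _ _ _ leb _ _ (measurable_itv _)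
      (@measurable_unit R) _ mup.1 mup.2).
    exact: sub.
  have mupt := measurable_funS (@measurable_unit R) sub mup.1.
  rewrite -(@ge0_integralZl _ _ _ leb _ (measurable_itv _) _ mupt)//; last first.
    by move=> u /sub; exact: mup.2.
  apply: ge0_le_integral => //.
  - by move=> u /sub; exact: mphi.2.
  - exact: (measurable_funS (@measurable_unit R) sub mphi.1).
  - by apply: emeasurable_funM => //; exact: measurable_cst.
  - move=> u /[dup] /sub /mphi.2 pu; rewrite /= in_itv/= => /andP[/ltW tu _].
    rewrite muleA -EFinM -[X in X <= _]mul1e; apply: lee_wpmul2r => //.
    by rewrite lee_fin mulrC ler_pdivlMr// mul1r.
pose f t := G t `^ r^-1.
have mf : measurable_fun unit_itv f by exact: (measurableT_comp (measurable_poweR _) mG.1).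
have f0 : L0 f.
  split => //; apply: aeW => t Ut; apply: fin_num_poweR.
  by rewrite ge0_fin_numE ?Gfin// mG.2.
have fr x : unit_itv x -> abs_pow f r x = G x.
  move=> Ux; rewrite /abs_pow gee0_abs ?poweR_ge0// -poweRrM mulVf// poweRe1//.
  exact: mG.2.
have mG0 : L0 G.
  by split; [exact: mG.1|apply: aeW => t Ut; rewrite ge0_fin_numE ?Gfin// mG.2].
have oscE t : oscillation (abs_pow f r) t = oscillation G t.
  have wE : rearr (abs_pow f r) = rearr G.
    by apply/funext => s; apply: eq_rearr => y _; exact: eq_distribution.
  by rewrite /oscillation /max_rearr wE.
have fY : ri_norm Y f <= D%:E * ri_norm X k.
  apply: (le_trans (HC f f0)); rewrite /D EFinM -muleA.
  apply: lee_wpmul2l; first by rewrite lee_fin ltW.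
  rewrite EFinD ge0_muleDl ?lee_fin ?(ltW H0) ?mulr_ge0 ?(ltW M0) ?(ltW N0)//.
  apply: leeD; last first.
    rewrite /Lr_norm (_ : \int[leb]_(x in unit_itv) abs_pow f r x =
      \int[leb]_(u in unit_itv) G u)//.
    by apply: eq_integral => x; rewrite inE => /fr.
  apply: le_trans (hardyX k mk).
  have mO := osc_quotient_mplus r^-1 hpsi mG0.
  under eq_fun do rewrite oscE.
  apply: ri_norm_le; [exact: mO.1|exact: (hardy_mplus hpsi mk).1|].
  move=> t Ut; rewrite !gee0_abs ?(mO.2 t Ut) ?((hardy_mplus hpsi mk).2 t Ut)//.
  have /unit_itvP/andP[t0 t1] := Ut.
  have pt := A0_pos hpsi Ut.
  rewrite /hardy invfM [(t^-1 * _)%R]mulrC EFinM -muleA [X in X <= _]muleC.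
  apply: lee_wpmul2l; first by rewrite lee_fin invr_ge0 ltW.
  apply: le_trans (jen t t0 (ltW t1)).
  have O0 := (oscillation_mplus mG0).2 t Ut.
  have Ole := oscillation_tail_le mphi Ut (Gfin t Ut).
  apply: (gt0_ler_poweR (ltW ri0)) => //.
    by rewrite in_itv/= leey O0.
  by rewrite in_itv/= leey (le_trans O0).
have mT : measurable_fun unit_itv (abs_pow (Top psi r h) r^-1).
  by apply: (abs_pow_mplus _ _).1; exact: measurable_Top.
have TY : ri_norm Y (abs_pow (Top psi r h) r^-1) <= D%:E * ri_norm X k.
  apply: le_trans fY; apply: ri_norm_le => // t Ut.
  rewrite !gee0_abs ?poweR_ge0//; apply: (gt0_ler_poweR (ltW ri0)).
  - by rewrite in_itv/= leey abse_ge0.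
  - by rewrite in_itv/= leey mG.2.
  have /unit_itvP/andP[t0 _] := Ut.
  have sub := tail_subset_unit (ltW t0).
  apply: le_trans (le_abse_integral leb (measurable_itv _) _) _.
    apply: (measurable_funS (@measurable_unit R) sub).
    apply: emeasurable_funM; first exact: emeasurable_funM.
    exact: measurable_inv_unit.
  rewrite le_eqVlt; apply/orP; left; apply/eqP; apply: eq_integral => u.
  rewrite inE => /sub/unit_itvP/andP[u0 _].
  by rewrite /phi !abseM (gee0_abs (psir0 u)) (@gee0_abs _ (u^-1)%:E)// lee_fin invr_ge0 ltW.
rewrite /cvx_norm invrK -poweR_EFin -poweRM ?lee_fin ?(ltW D0)//; last exact: ri_norm_ge0 mk.1.
apply: (gt0_ler_poweR (ltW r0)) => //.
- by rewrite in_itv/= leey ri_norm_ge0.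
- by rewrite in_itv/= leey mule_ge0 ?lee_fin ?(ltW D0)//; exact: ri_norm_ge0 mk.1.
Qed.

End Equivalence.

Theorem theorem3 (R : realType) (r : R) (hr0 : (0 < r)%R) (hr1 : (r <= 1)%R)
  (X Y : ri_space R) (psi : R -> R) (hpsi : class_A0 psi) :
  [<-> exists2 C : R, (0 < C)%R &
         forall f : R -> \bar R, L0 f ->
           ri_norm Y f <=
             C%:E * (ri_norm X (fun t => oscillation (abs_pow f r) t `^ r^-1
                                         * ((psi t)^-1)%:E)
                     + Lr_norm r f)
     ; exists2 C : R, (0 < C)%R &
         forall h : R -> \bar R, cvx_mem X r^-1 h ->
           cvx_norm Y r^-1 (Top psi r h) <= C%:E * cvx_norm X r^-1 h
     ; exists2 C : R, (0 < C)%R &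
         forall f : R -> \bar R, ri_mem X f ->
           ri_norm Y (Qop psi r f) <= C%:E * ri_norm X f ].
Proof.
tfae.
- exact: Top_bound_of_oscillation_bound.
- exact: Qop_bound_of_Top_bound.
- exact: oscillation_bound_of_Qop_bound.
Qed.
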